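(* For every integer $n\ge 3$ there exists a configuration $(3,3)$ $GDD(n,2,6;\lambda_1,\lambda_2)$ whose indices $(\lambda_1,\lambda_2)$ are the minimal indices for configuration $(3,3)$, namely: \begin{itemize} \item $(\lambda_1,\lambda_2)=\left(\frac{2n}{3},\,n-1\right)$ if $n\equiv 0 \pmod 6$; \item $(\lambda_1,\lambda_2)=\left(n,\,\frac{3(n-1)}{2}\right)$ if $n\equiv 1 \pmod 6$; \item $(\lambda_1,\lambda_2)=\left(6n,\,9(n-1)\right)$ if $n\equiv 2 \pmod 6$; \item $(\lambda_1,\lambda_2)=\left(\frac{n}{3},\,\frac{n-1}{2}\right)$ if $n\equiv 3 \pmod 6$; \item $(\lambda_1,\lambda_2)=\left(2n,\,3(n-1)\right)$ if $n\equiv 4 \pmod 6$; \item $(\lambda_1,\lambda_2)=\left(3n,\,\frac{9(n-1)}{2}\right)$ if $n\equiv 5 \pmod 6$. \end{itemize}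
   Context: A $GDD(n,2,6;\lambda_1,\lambda_2)$ is a finite collection (repetitions allowed) of $6$-element subsets, called blocks, of a $2n$-element set $X$ partitioned into two groups of size $n$, such that every point lies in the same number $r$ of blocks, any two distinct points of the same group lie together in exactly $\lambda_1$ blocks, and any two points from different groups lie together in exactly $\lambda_2$ blocks. It has configuration $(3,3)$ if every block has exactly $3$ points in each group. The minimal indices for configuration $(3,3)$ and a given $n$ are the smallest positive integers $\lambda_1,\lambda_2$ such that $\lambda_2=\frac{3\lambda_1(n-1)}{2n}$ and both $\frac{\lambda_1 n(n-1)+\lambda_2n^2}{15}$ and $\frac{\lambda_1(n-1)+\lambda_2 n}{5}$ are integers. *)

(* Defs.v *)
From HB Require Import structures.
From mathcomp Require Import all_boot all_order all_algebra.

Set Implicit Arguments.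
Unset Strict Implicit.
Unset Printing Implicit Defensive.

Import Order.TTheory GRing.Theory Num.Theory.

(* GDD(n, m, k; l1, l2) on the point set X.  [G] is the set of groups, and the
   collection of blocks is a sequence, so that blocks may be repeated; [count]
   counts blocks with multiplicity. *)
Record is_gdd (n m k l1 l2 : nat) (X : finType) (G : {set {set X}})
    (Bs : seq {set X}) : Prop := IsGDD {
  gdd_points : #|X| = m * n;
  gdd_groups : partition G [set: X];
  gdd_num_groups : #|G| = m;
  gdd_group_size : forall A, A \in G -> #|A| = n;
  gdd_block_size : forall B, B \in Bs -> #|B| = k;
  gdd_replication :
    exists r : nat, forall x : X, count (fun B : {set X} => x \in B) Bs = r;
  gdd_same_group : forall (A : {set X}) (x y : X),
    A \in G -> x \in A -> y \in A -> x != y ->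
    count (fun B : {set X} => (x \in B) && (y \in B)) Bs = l1;
  gdd_diff_group : forall (A A' : {set X}) (x y : X),
    A \in G -> A' \in G -> A != A' -> x \in A -> y \in A' ->
    count (fun B : {set X} => (x \in B) && (y \in B)) Bs = l2
}.

Definition has_configuration_3_3 (X : finType) (G : {set {set X}})
    (Bs : seq {set X}) : Prop :=
  forall B A, B \in Bs -> A \in G -> #|B :&: A| = 3.

Definition admissible_indices_3_3 (n l1 l2 : nat) : Prop :=
  [/\ 0 < l1, 0 < l2,
      (l2%:R = 3 * l1%:R * (n%:R - 1) / (2 * n%:R) :> rat)%R,
      15 %| l1 * n * (n - 1) + l2 * n ^ 2
    & 5 %| l1 * (n - 1) + l2 * n].

(* [admissible_indices_3_3] fixes the ratio l2 / l1, so for n > 1 minimality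
   of l1 and of l2 are attained together. *)
Definition minimal_indices_3_3 (n l1 l2 : nat) : Prop :=
  admissible_indices_3_3 n l1 l2 /\
  (forall l1' l2' : nat,
     admissible_indices_3_3 n l1' l2' -> l1 <= l1' /\ l2 <= l2').

(* The quotients are taken in [rat], so that the equations also assert that
   they are integers. *)
Definition indices_formula_3_3 (n l1 l2 : nat) : Prop :=
  let q : rat := (n%:R)%R in
  let a : rat := (l1%:R)%R in
  let b : rat := (l2%:R)%R in
  [/\ n = 0 %[mod 6] -> (a = 2 * q / 3 /\ b = q - 1)%R,
      n = 1 %[mod 6] -> (a = q /\ b = 3 * (q - 1) / 2)%R
    & [/\ n = 2 %[mod 6] -> (a = 6 * q /\ b = 9 * (q - 1))%R,
          n = 3 %[mod 6] -> (a = q / 3 /\ b = (q - 1) / 2)%R,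
          n = 4 %[mod 6] -> (a = 2 * q /\ b = 3 * (q - 1))%R
        & n = 5 %[mod 6] -> (a = 3 * q /\ b = 9 * (q - 1) / 2)%R]].

(* Main.v *)
(* A block is a pair of triples (T, S), one in each group.

   If T runs over a triple system TS(n, l) on Z_n and j over Z_n, the pairs (T, T + j)
   cover equal pairs l n times and cross pairs 3 l (n - 1) / 2 times.  This settles n
   prime to 3, with l = 1, 6, 2, 3 for n = 1, 2, 4, 5 mod 6.

   For n = 3 m, let a TS(n, l) contain p disjoint parallel classes and q m further
   triples, q <= p.  Multiply m of these triples with each of q classes, in either
   order, and each of the other p - q classes with itself: this gives the indices
   (l m, p + q).  Such systems come from TS(m, l) in three columns Z_m and from
   transversals {t, t + i, t + j}, with (i, j) = (i, 2 i) and l = 1 if m = 3 mod 6, and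
   (i, j) = (i, 2 i), (i, 2 i + 1) and l = 2 if m is even.  As there is no TS(m, 2) for
   m = 2 mod 6, there one takes a triple packing missing a double edge and exchanges four
   transversals for six triples that cover the missing edges.

   For n = 3 m with m prime to 6, Z_m x Z_m acts on the six columns along pairwise
   independent directions, so only the numbers of points of the base blocks in the
   columns and the differences inside a column matter.  With Bose's triples
   {(0, c), (d, c), (0, c + 1)}, each difference d used once per column, it remains to
   pair the triples of the two groups so that the columns are met uniformly. *)

Require Import Defs.
From mathcomp Require Import all_boot all_order all_fingroup all_algebra zify lra.

Set Implicit Arguments.
Unset Strict Implicit.
Unset Printing Implicit Defensive.

Import GRing.Theory Num.Theory.

(** * Cover counts and the passage to group divisible designs *)

Definition cross_cover (I P P' : finType) (T : I -> {set P}) (S : I -> {set P'})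
  (x : P) (y : P') : nat := \sum_i (x \in T i) * (y \in S i).

(** The weight [w] may vary with the pair, so that families missing some pairs can be put together
    by adding weights. *)
Definition decomposes (I P : finType) (T : I -> {set P}) (w : P -> P -> nat) :=
  (forall i, #|T i| = 3) /\ forall x y, x != y -> cross_cover T T x y = w x y.

Definition triple_system (I P : finType) (T : I -> {set P}) (l : nat) :=
  decomposes T (fun _ _ => l).

(** Both groups are copies of one set [P]; [T i] and [S i] are the two halves of block [i]. *)
Definition config_design (n l1 l2 : nat) :=
  exists (P I : finType) (T S : I -> {set P}),
    [/\ #|P| = n, triple_system T l1, triple_system S l1
      & forall x y, cross_cover T S x y = l2].

Lemma card_sum_mem (P : finType) (A : {set P}) : \sum_x (x \in A) = #|A|.
Proof. by rewrite -sum1_card [RHS]big_mkcond; apply: eq_bigr => x _; case: ifP. Qed.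

Lemma cross_coverC (I P P' : finType) (T : I -> {set P}) (S : I -> {set P'}) x y :
  cross_cover T S x y = cross_cover S T y x.
Proof. by apply: eq_bigr => i _; rewrite mulnC. Qed.

Lemma sum_cross_cover (I P P' : finType) (T : I -> {set P}) (S : I -> {set P'}) x :
  (forall i, #|S i| = 3) ->
  \sum_y cross_cover T S x y = 3 * \sum_i (x \in T i).
Proof.
move=> S3; rewrite exchange_big big_distrr; apply: eq_bigr => i _.
by rewrite -big_distrr /= card_sum_mem S3 mulnC.
Qed.

(** Count the points [y] over all triples through [x]: each such triple contributes 3, one of them
    for [y = x]. *)
Lemma degree_of_decomposes (I P : finType) (T : I -> {set P}) w x :
  decomposes T w -> 2 * \sum_i (x \in T i) = \sum_(y | y != x) w x y.
Proof.
case=> T3 Tw; have := sum_cross_cover T x T3.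
rewrite (bigD1 x) //= (eq_bigr (w x)); last by move=> y yx; rewrite Tw 1?eq_sym.
have -> : cross_cover T T x x = \sum_i (x \in T i).
  by apply: eq_bigr => i _; rewrite mulnn; case: (_ \in _).
lia.
Qed.

Lemma degree_triple_system (I P : finType) (T : I -> {set P}) l x :
  triple_system T l -> 2 * \sum_i (x \in T i) = l * #|P|.-1.
Proof.
move=> /degree_of_decomposes->.
by rewrite sum_nat_const mulnC (eq_card (_ : _ =i predC1 x)) // cardC1.
Qed.

Lemma sum_bool_pair (P : finType) (F : bool * P -> nat) :
  \sum_z F z = \sum_x F (false, x) + \sum_x F (true, x).
Proof. rewrite addnC -(big_bool _ (fun b => \sum_x F (b, x))) pair_big /=.
by apply: eq_bigr => -[]. Qed.

Lemma gdd_of_config_design (n l1 l2 : nat) : 0 < n ->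
  config_design n l1 l2 ->
  exists (X : finType) (G : {set {set X}}) (Bs : seq {set X}),
    is_gdd n 2 6 l1 l2 G Bs /\ has_configuration_3_3 G Bs.
Proof.
move=> n0 [P [I [T [S [cP [T3 Tl] [S3 Sl] TSl]]]]].
pose X := (bool * P)%type.
pose A b : {set X} := [set z | b == z.1].
pose G := preim_partition (fun z : X => z.1) [set: X].
pose B i : {set X} := [set z | z.2 \in if z.1 then S i else T i].
have GA C : C \in G -> exists b, C = A b.
  case/imsetP=> z _ ->; exists z.1; apply/setP=> y; by rewrite !inE.
have AG b : A b \in G.
  have [x _] : exists x : P, x \in P by apply/card_gt0P; rewrite cP.
  apply/imsetP; exists (b, x) => //; apply/setP=> y; by rewrite !inE.
have cBA i b : #|B i :&: A b| = 3.
  rewrite -card_sum_mem sum_bool_pair.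
  case: b.
    rewrite big1 => [|x _]; last by rewrite !inE andbF.
    by rewrite -(S3 i) -card_sum_mem; apply: eq_bigr => x _; rewrite !inE andbT.
  rewrite [X in _ + X]big1 => [|x _]; last by rewrite !inE andbF.
  by rewrite addn0 -(T3 i) -card_sum_mem; apply: eq_bigr => x _; rewrite !inE andbT.
have cA b : #|A b| = n.
  have -> : A b = setX [set b] [set: P] by apply/setP=> y; rewrite !inE andbT eq_sym.
  by rewrite cardsX cards1 cardsT cP mul1n.
have cnt (p : pred {set X}) : count p [seq B i | i <- index_enum I] = \sum_i p (B i).
  by rewrite count_map -sum1_count big_mkcond; apply: eq_bigr => i _ /=; case: (p _).
exists X, G, [seq B i | i <- index_enum I]; split; last first.
  by move=> _ C /mapP[i _ ->] /GA[b ->].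
split.
- by rewrite card_prod card_bool cP.
- exact: preim_partitionP.
- have -> : G = [set A false; A true].
    apply/setP=> C; rewrite !inE; apply/idP/idP.
      by move=> /GA[[] ->]; rewrite eqxx ?orbT.
    by case/orP=> /eqP->.
  rewrite cards2; case: eqP => // /setP E.
  have [x _] : exists x : P, x \in P by apply/card_gt0P; rewrite cP.
  by have := E (true, x); rewrite !inE.
- by move=> C /GA[b ->].
- move=> _ /mapP[i _ ->].
  rewrite -card_sum_mem sum_bool_pair -[6]/(3 + 3) -{1}(T3 i) -(S3 i) -!card_sum_mem.
  by congr (_ + _); apply: eq_bigr => x _; rewrite !inE.
(* Each block through a point has 3 points in the other group, whose n points are each met [l2]
   times; hence [n * l2] is 3 times the replication number. *)
- exists (n * l2 %/ 3) => -[b x]; rewrite cnt.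
  have -> : \sum_i ((b, x) \in B i) = \sum_i (x \in if b then S i else T i).
    by apply: eq_bigr => i _; rewrite !inE.
  have : n * l2 = 3 * \sum_i (x \in if b then S i else T i).
    case: b.
      rewrite -(sum_cross_cover _ _ T3) (eq_bigr (fun _ => l2)).
        by rewrite sum_nat_const cP.
      by move=> y _; rewrite cross_coverC TSl.
    rewrite -(sum_cross_cover _ _ S3) (eq_bigr (fun _ => l2)).
      by rewrite sum_nat_const cP.
    by move=> y _; rewrite TSl.
  by move=> ->; rewrite mulKn.
- move=> C [b x] [b' y] /GA[b0 ->]; rewrite !inE /= => /eqP<- /eqP<- xy; rewrite cnt.
  have {}xy : x != y by apply: contra xy => /eqP->.
  case: b0; [rewrite -(Sl _ _ xy)|rewrite -(Tl _ _ xy)];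
    by apply: eq_bigr => i _; rewrite !inE mulnb.
- move=> C C' [b x] [b' y] /GA[b0 ->] /GA[b1 ->] bb; rewrite !inE /= => /eqP E0 /eqP E1.
  subst b b'; have {}bb : b0 != b1 by apply: contra bb => /eqP->.
  rewrite cnt; case: b0 b1 bb => -[] // _.
    by rewrite -(TSl y x) cross_coverC; apply: eq_bigr => i _; rewrite !inE mulnb.
  by rewrite -(TSl x y); apply: eq_bigr => i _; rewrite !inE mulnb.
Qed.

(** * Families of triples *)

Lemma bijection_of_card (P P' : finType) :
  #|P| = #|P'| -> exists g : P -> P', bijective g.
Proof.
move=> e; exists (fun x => enum_val (cast_ord e (enum_rank x))).
exists (fun y => enum_val (cast_ord (esym e) (enum_rank y))) => x;
  by rewrite enum_valK ?cast_ordK ?cast_ordKV enum_rankK.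
Qed.

Lemma card_preim_bij (P P' : finType) (g : P -> P') (A : {set P'}) :
  bijective g -> #|g @^-1: A| = #|A|.
Proof. by move=> gb; rewrite on_card_preimset //; exact: onW_bij. Qed.

Lemma decomposes_preim (I P P' : finType) (T : I -> {set P'}) w (g : P -> P') :
  bijective g -> decomposes T w ->
  decomposes (fun i => g @^-1: T i) (fun x y => w (g x) (g y)).
Proof.
move=> gb [T3 Tw]; split=> [i|x y xy]; first by rewrite card_preim_bij.
rewrite -Tw ?(inj_eq (bij_inj gb)) //.
by apply: eq_bigr => i _; rewrite !inE.
Qed.

Lemma eq_decomposes (I P : finType) (T : I -> {set P}) w w' :
  decomposes T w -> (forall x y, x != y -> w x y = w' x y) -> decomposes T w'.
Proof. by case=> T3 Tw ww; split=> // x y xy; rewrite Tw ?ww. Qed.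

Lemma triple_system_transport (I P P' : finType) (T : I -> {set P'}) l :
  #|P| = #|P'| -> triple_system T l -> exists S : I -> {set P}, triple_system S l.
Proof.
move=> /bijection_of_card[g gb] Tl; exists (fun i => g @^-1: T i).
exact: decomposes_preim Tl.
Qed.

Definition sumf (I J : finType) Z (T : I -> Z) (S : J -> Z) (k : I + J) : Z :=
  match k with inl i => T i | inr j => S j end.

Lemma cross_cover_sum (I J P P' : finType) (T : I -> {set P}) (T' : J -> {set P})
    (S : I -> {set P'}) (S' : J -> {set P'}) x y :
  cross_cover (sumf T T') (sumf S S') x y =
  cross_cover T S x y + cross_cover T' S' x y.
Proof. by rewrite /cross_cover big_sumType. Qed.

Lemma decomposes_sum (I J P : finType) (T : I -> {set P}) (T' : J -> {set P}) w w' :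
  decomposes T w -> decomposes T' w' ->
  decomposes (sumf T T') (fun x y => w x y + w' x y).
Proof.
move=> [T3 Tw] [T3' Tw']; split=> [[i|j]|x y xy] //=.
by rewrite cross_cover_sum Tw ?Tw'.
Qed.

Lemma set3_card (P : finType) (a b c : P) :
  a != b -> a != c -> b != c -> #|[set a; b; c]| = 3.
Proof. by move=> ab ac bc; rewrite -setUA cardsU1 cards2 !inE negb_or ab ac bc. Qed.

Lemma mem_set3 (P : finType) (a b c x : P) :
  a != b -> a != c -> b != c ->
  (x \in [set a; b; c]) = (x == a) + (x == b) + (x == c) :> nat.
Proof.
move=> ab ac bc; rewrite !inE.
have [->|_] := eqVneq x a; first by rewrite (negPf ab) (negPf ac).
by have [->|_] := eqVneq x b; first by rewrite (negPf bc).
Qed.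

Lemma sum_eq1 (P : finType) (a : P) : \sum_x (x == a) = 1.
Proof. by rewrite (bigD1 a) //= eqxx big1 // => x /negPf->. Qed.

Lemma sum_pairE (I J : finType) (F : I * J -> nat) :
  \sum_k F k = \sum_i \sum_j F (i, j).
Proof. by rewrite (pair_big xpredT xpredT (fun i j => F (i, j))); apply: eq_bigr => -[]. Qed.

(** * Designs from triple systems *)

(** If [x] lies in [S i], exactly 3 translates of [S i] contain a given [y]. So the cross count is 3
    times the degree of [x], and twice that degree is [l * n.-1]. Inside a group each of the n
    shifts is again a triple system of index [l]. *)
Lemma shift_design (I P : finType) (T : I -> {set P}) n l l2 :
  #|P| = n -> 0 < n -> triple_system T l -> 2 * l2 = 3 * (l * n.-1) ->
  config_design n (l * n) l2.
Proof.
case: n => // n cP _ Tl l2E; pose V := 'I_n.+1.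
have [S Sl] : exists S : I -> {set V}, triple_system S l.
  by apply: triple_system_transport Tl; rewrite card_ord.
pose sh (j : V) := (fun x : V => x - j)%R.
have shb j : bijective (sh j) by exists (fun x : V => x + j)%R => x; rewrite /sh ?addrK ?subrK.
exists V, (I * V)%type, (fun ij => S ij.1), (fun ij => sh ij.2 @^-1: S ij.1).
have S3 := Sl.1; split=> [||| x y].
- by rewrite card_ord.
- split=> [[i j]|x y xy] //=.
  rewrite -(Sl.2 x y xy) mulnC /cross_cover sum_pairE /=.
  by rewrite big_distrr; apply: eq_bigr => i _; rewrite sum_nat_const card_ord.
- split=> [[i j]|x y xy] /=; first by rewrite card_preim_bij.
  rewrite /cross_cover sum_pairE /=.
  rewrite exchange_big (eq_bigr (fun=> l)); first by rewrite sum_nat_const card_ord mulnC.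
  move=> j _; rewrite -(Sl.2 (sh j x) (sh j y)) ?(inj_eq (bij_inj (shb j))) //.
  by apply: eq_bigr => i _; rewrite !inE.
- rewrite /cross_cover sum_pairE /=.
  rewrite (eq_bigr (fun i => 3 * (x \in S i))) => [|i _].
    rewrite -big_distrr /=; have := degree_triple_system x Sl; rewrite card_ord /=; lia.
  rewrite -big_distrr /= mulnC -(S3 i) -card_sum_mem; congr (_ * _).
  rewrite (reindex_inj (h := fun j : V => y - j)%R) /=; last first.
    by move=> a b /(congr1 (fun z => y - z)%R); rewrite !subKr.
  by apply: eq_bigr => j _; rewrite !inE /sh subKr.
Qed.

Lemma cross_cover_reindex (I J P P' : finType) (h : J -> I) (T : I -> {set P})
    (S : I -> {set P'}) x y :
  bijective h -> cross_cover (T \o h) (S \o h) x y = cross_cover T S x y.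
Proof. by move=> hb; rewrite /cross_cover (reindex h) //=; exact: onW_bij. Qed.

Lemma cross_cover_prod (I J P P' : finType) (T : I -> {set P}) (S : I -> J -> {set P'}) x y :
  cross_cover (fun k : I * J => T k.1) (fun k => S k.1 k.2) x y =
  \sum_i (x \in T i) * \sum_j (y \in S i j).
Proof.
rewrite /cross_cover sum_pairE /=.
by apply: eq_bigr => i _; rewrite big_distrr.
Qed.

Lemma cross_cover_fst (I J P P' : finType) (T : I -> {set P}) (S : I -> {set P'}) x y :
  cross_cover (fun k : I * J => T k.1) (fun k => S k.1) x y = #|J| * cross_cover T S x y.
Proof.
rewrite /cross_cover sum_pairE /=.
by rewrite big_distrr /=; apply: eq_bigr => i _; rewrite sum_nat_const.
Qed.

Lemma sum_pair2 (I J : finType) (F : J -> nat) :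
  \sum_(k : I * J) F k.2 = #|I| * \sum_i F i.
Proof. by rewrite -(pair_big xpredT xpredT (fun _ j => F j)) /= sum_nat_const. Qed.

Lemma card_triple_system (I P : finType) (T : I -> {set P}) l :
  triple_system T l -> 6 * #|I| = #|P| * (l * #|P|.-1).
Proof.
move=> Tl.
have -> : 6 * #|I| = \sum_x 2 * \sum_i (x \in T i).
  rewrite -big_distrr exchange_big /= (eq_bigr (fun=> 3)) => [|i _].
    by rewrite sum_nat_const [6 * _]mulnC mulnCA.
  by rewrite card_sum_mem Tl.1.
by rewrite (eq_bigr (fun=> l * #|P|.-1)) ?sum_nat_const // => x _; exact: degree_triple_system.
Qed.

(* With m = #|M|: each triple outside the first q classes meets one triple of a class
   of the other side, once in either order, and the remaining classes are
   multiplied with themselves. *)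
Lemma parallel_classes_design (J K M Y : finType) (R : J -> {set Y})
    (C : K * M -> {set Y}) (q n l : nat) :
  #|Y| = n -> n = 3 * #|M| -> q <= #|K| -> 2 * (q + #|K|) = l * n.-1 ->
  triple_system (sumf R C) l ->
  (forall k y, \sum_j (y \in C (k, j)) = 1) ->
  config_design n (l * #|M|) (q + #|K|).
Proof.
move=> cY nM qK rE RC C1; set m := #|M|.
have R3 j : #|R j| = 3 by exact: RC.1 (inl j).
have C3 k : #|C k| = 3 by exact: RC.1 (inr k).
(* Counting triples leaves exactly [q * #|M|] of them outside the classes, so [h] can cut them into
   [q] batches, one for each of the first [q] classes. *)
have cJ : #|J| = q * #|M|.
  have := card_triple_system RC; rewrite cY -rE card_sum card_prod nM.
  by rewrite /m; clear; move: #|J| #|K| #|M| => a b c; nia.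
have dR y : \sum_j (y \in R j) = q.
  have dC : \sum_k (y \in C k) = #|K|.
    rewrite sum_pairE (eq_bigr (fun=> 1)) => [|k _]; last by rewrite C1.
    by rewrite sum_nat_const muln1.
  have := degree_triple_system y RC; rewrite cY big_sumType /= dC; lia.
have [g gb] : exists g : 'I_q + 'I_(#|K| - q) -> K, bijective g.
  by apply: bijection_of_card; rewrite card_sum !card_ord; lia.
have [h hb] : exists h : 'I_q * M -> J, bijective h.
  by apply: bijection_of_card; rewrite card_prod !card_ord cJ.
pose Ca (k : 'I_q * M) := C (g (inl k.1), k.2).
pose Cb (k : 'I_(#|K| - q) * M) := C (g (inr k.1), k.2).
pose T1 (k : ('I_q * M) * M) := (R \o h) k.1.
pose S1 (k : ('I_q * M) * M) := Ca (k.1.1, k.2).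
pose T3 (k : ('I_(#|K| - q) * M) * M) := Cb k.1.
pose S3 (k : ('I_(#|K| - q) * M) * M) := Cb (k.1.1, k.2).
have cov x y : x != y ->
    cross_cover (R \o h) (R \o h) x y + cross_cover Ca Ca x y + cross_cover Cb Cb x y = l.
  move=> xy; rewrite cross_cover_reindex // -(RC.2 x y xy) cross_cover_sum -addnA.
  congr (_ + _).
  rewrite -(cross_cover_reindex
    (h := fun k : ('I_q + 'I_(#|K| - q)) * M => (g k.1, k.2))); last first.
    case: gb => g' gK g'K; exists (fun k => (g' k.1, k.2)) => -[a b] /=; by rewrite ?gK ?g'K.
  by rewrite /cross_cover !sum_pairE big_sumType.
have S1E x y : cross_cover S1 S1 x y = m * cross_cover Ca Ca x y.
  rewrite /cross_cover !sum_pairE big_distrr; apply: eq_bigr => a _ /=.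
  by rewrite /S1 /= sum_nat_const.
have S3E x y : cross_cover S3 S3 x y = m * cross_cover Cb Cb x y.
  rewrite /cross_cover !sum_pairE big_distrr; apply: eq_bigr => a _ /=.
  by rewrite /S3 /= sum_nat_const.
exists Y, (('I_q * M) * M + ('I_q * M) * M + ('I_(#|K| - q) * M) * M)%type,
  (sumf (sumf T1 S1) T3), (sumf (sumf S1 T1) S3); split => // [||x y].
- split=> [[[k|k]|k]|x y xy] /=; rewrite ?C3 ?R3 //.
  rewrite !cross_cover_sum S1E !cross_cover_fst -/m -!mulnDr mulnC.
  by rewrite cov.
- split=> [[[k|k]|k]|x y xy] /=; rewrite ?C3 ?R3 //.
  rewrite !cross_cover_sum S1E S3E !cross_cover_fst -/m -!mulnDr mulnC.
  by rewrite [cross_cover Ca _ _ _ + _]addnC cov.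
(* A class has one triple through [y'], so every triple of [R] through [x'] counts once, and there
   are [q] of those. *)
have E1 x' y' : cross_cover T1 S1 x' y' = q.
  rewrite /T1 /S1 (cross_cover_prod (R \o h) (fun (a : 'I_q * M) j => Ca (a.1, j))).
  rewrite (eq_bigr (fun i => (x' \in R (h i)) : nat)) => [|i _]; last by rewrite /Ca /= C1 muln1.
  transitivity (\sum_j (x' \in R j)); last exact: dR.
  by rewrite [RHS](reindex h) //; exact: onW_bij.
rewrite !cross_cover_sum E1 [cross_cover S1 _ _ _]cross_coverC E1.
rewrite /T3 /S3 (cross_cover_prod Cb (fun a j => Cb (a.1, j))).
rewrite (eq_bigr (fun i => (x \in Cb i) : nat)) => [|i _]; last by rewrite /Cb /= C1 muln1.
rewrite sum_pairE (eq_bigr (fun=> 1)) => [|k _]; last by rewrite /Cb /= C1.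
by rewrite sum_nat_const card_ord; lia.
Qed.

(** * Three columns and parallel classes *)

Definition in_column (P C : finType) (A : {set P}) (c : C) : {set P * C} :=
  setX A [set c].

Lemma decomposes_columns (I P C : finType) (T : C -> I -> {set P}) w :
  (forall c, decomposes (T c) (w c)) ->
  decomposes (fun k : I * C => in_column (T k.2 k.1) k.2)
    (fun x y => if x.2 == y.2 then w x.2 x.1 y.1 else 0).
Proof.
move=> Tw; split=> [[i c]|[x c] [y d] xy] /=.
  by rewrite cardsX cards1 muln1 (Tw c).1.
rewrite /cross_cover sum_pairE exchange_big (bigD1 c) //= [X in _ + X]big1 => [|e ec].
  rewrite addn0; case: eqP => [cd|/eqP cd].
    rewrite -cd -(Tw c).2; last by apply: contra xy => /eqP->; rewrite cd.
    by apply: eq_bigr => i _; rewrite !inE eqxx !andbT.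
  by rewrite big1 // => i _; rewrite !inE [d == c]eq_sym (negPf cd) !andbF muln0.
by rewrite big1 // => i _; rewrite !inE [c == e]eq_sym (negPf ec) andbF.
Qed.

(** A transversal of the columns, encoded as the graph of [f]. *)
Definition cross_section (P C : finType) (f : C -> P) : {set P * C} :=
  [set z | z.1 == f z.2].

Lemma card_cross_section (P C : finType) (f : C -> P) : #|cross_section f| = #|C|.
Proof.
rewrite -card_sum_mem sum_pairE exchange_big (eq_bigr (fun=> 1)) => [|c _].
  by rewrite sum_nat_const muln1.
by rewrite -(sum_eq1 (f c)); apply: eq_bigr => x _; rewrite !inE.
Qed.

Lemma decomposes_cross_sections (I P : finType) (f : I -> 'I_3 -> P) :
  decomposes (fun i => cross_section (f i))
    (fun x y => if x.2 == y.2 then 0 else \sum_i (x.1 == f i x.2) * (y.1 == f i y.2)).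
Proof.
split=> [i|[x c] [y d] xy] /=; first by rewrite card_cross_section card_ord.
case: eqP => [cd|/eqP cd]; last by apply: eq_bigr => i _; rewrite !inE.
rewrite /cross_cover big1 // => i _; rewrite !inE /= -cd mulnb.
have [Ex|//] := eqVneq x (f i c); case: eqVneq => //= Ey.
by rewrite Ex Ey cd eqxx in xy.
Qed.

(** The second condition makes every [k : K] a parallel class: as [t] varies, the sections for
    [(k, t)] meet each point once. *)
Definition resolvable_transversals (V K : finType) (f : K * V -> 'I_3 -> V) l :=
  (forall c d x y, c != d -> \sum_k (x == f k c) * (y == f k d) = l) /\
  (forall k c, injective (fun t => f (k, t) c)).

Lemma class_cross_sections (V K : finType) (f : K * V -> 'I_3 -> V) l k y :
  resolvable_transversals f l -> \sum_t (y \in cross_section (f (k, t))) = 1.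
Proof.
case=> _ fi; transitivity (\sum_x (x == y.1)); last exact: sum_eq1.
rewrite [RHS](reindex_inj (fi k y.2)).
by apply: eq_bigr => t _; rewrite !inE eq_sym.
Qed.

(** Pairs inside a column are covered by a copy of [T], pairs in different columns by the
    transversals, which supply the parallel classes. *)
Lemma inflated_design (I V K : finType) (T : I -> {set V}) (f : K * V -> 'I_3 -> V) l q :
  triple_system T l -> resolvable_transversals f l ->
  q <= #|K| -> 2 * (q + #|K|) = l * (3 * #|V|).-1 ->
  config_design (3 * #|V|) (l * #|V|) (q + #|K|).
Proof.
move=> Tl fl qK rE.
apply: (@parallel_classes_design _ K V (V * 'I_3)%type
  (fun k : I * 'I_3 => in_column (T k.1) k.2) (fun k => cross_section (f k))) => //.
- by rewrite card_prod card_ord mulnC.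
- apply: eq_decomposes (decomposes_sum
    (@decomposes_columns I V 'I_3 (fun=> T) (fun _ _ _ => l) (fun=> Tl))
    (decomposes_cross_sections f)) _.
  by move=> x y _; case: eqP => [_|/eqP xy]; rewrite ?addn0 ?fl.1.
- by move=> k y; exact: class_cross_sections fl.
Qed.

Lemma sum_eq_inj (P : finType) (h : P -> P) y : injective h -> \sum_x (y == h x) = 1.
Proof.
move=> hi; rewrite -(sum_eq1 y) [RHS](reindex_inj hi).
by apply: eq_bigr => x _; rewrite eq_sym.
Qed.

Lemma sum_pair_eq_inj (P Q : finType) (h : P * Q -> P * Q) x y :
  injective h -> \sum_k (x == (h k).1) * (y == (h k).2) = 1.
Proof.
move=> hi; rewrite -(sum_eq_inj (x, y) hi).
by apply: eq_bigr => k _; rewrite mulnb.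
Qed.

(** The difference [y - x] must be [h i - g i], which determines [i] and then [j]. *)
Lemma sum_shift_pairs (V : finZmodType) (g h : V -> V) x y :
  injective (fun i => h i - g i)%R ->
  \sum_i \sum_j (x == j + g i)%R * (y == j + h i)%R = 1.
Proof.
move=> hg; rewrite pair_bigA /=.
apply: (@sum_pair_eq_inj _ _ (fun k : V * V => (k.2 + g k.1, k.2 + h k.1)%R)).
move=> [i t] [i' t'] [E1 E2].
have K j s : (h j - g j = s + h j - (s + g j))%R by rewrite [(s + h j)%R]addrC addrKA.
have e : i = i' by apply: hg; rewrite /= (K i t) (K i' t') E1 E2.
by move: E1; rewrite e => /addIr->.
Qed.

(** Between columns c < d the difference is (d - c) i with d - c equal to 1 or 2, and doubling is
    injective when no element has order 2. *)
Lemma odd_transversals (V : finZmodType) :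
  (forall x : V, x + x = 0 -> x = 0)%R ->
  resolvable_transversals (fun (k : V * V) (c : 'I_3) => k.2 + k.1 *+ c)%R 1.
Proof.
move=> V2; split=> [c d x y cd|k c]; last by move=> t t' /= /addIr.
wlog cd' : c d x y cd / c < d => [H|].
  have [lt|lt] := ltnP c d; first exact: H.
  have lt' : d < c by rewrite ltn_neqAle lt eq_sym cd.
  by under eq_bigr do rewrite mulnC; apply: H => //; rewrite eq_sym.
rewrite sum_pairE.
apply: (@sum_shift_pairs _ (fun i : V => i *+ c)%R (fun i : V => i *+ d)%R) => i i'.
rewrite -!mulrnBr ?(ltnW cd') // => e.
have : d - c = 1 \/ d - c = 2 by have := ltn_ord d; lia.
case=> E; move: e; rewrite E // !mulr2n => e.
by apply/eqP; rewrite -subr_eq0; apply/eqP/V2; rewrite addrACA -opprD e subrr.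
Qed.

Lemma sum_double (F : nat -> nat) n :
  \sum_(i < n) (F i.*2 + F i.*2.+1) = \sum_(j < n + n) F j.
Proof.
rewrite addnn; elim: n => [|n IHn]; first by rewrite !big_ord0.
by rewrite big_ord_recr IHn doubleS !big_ord_recr /= addnA.
Qed.

(** The numbers 2 i + b run through two full periods of residues. *)
Lemma sum_eq_double n (d : 'I_n.+2) :
  \sum_(k : 'I_n.+2 * bool) (d == k.1 *+ 2 + k.2%:R)%R = 2.
Proof.
have valE (i : 'I_n.+2) (b : bool) : val (i *+ 2 + b%:R)%R = (i.*2 + b) %% n.+2.
  by rewrite mulr2n /= modnDml -addnn; case: b; rewrite /= ?addn0 ?(modn_small (m := 1)).
pose F j := (val d == j %% n.+2) : nat.
transitivity (\sum_(j < n.+2 + n.+2) F j).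
  rewrite -sum_double sum_pairE; apply: eq_bigr => i _.
  by rewrite big_bool addnC -!val_eqE !valE addn0 addn1.
have E : \sum_(j < n.+2) (val d == j) = 1.
  by transitivity (\sum_j (j == d)); [apply: eq_bigr => j _; rewrite eq_sym|exact: sum_eq1].
transitivity (\sum_(j < n.+2) (val d == j) + \sum_(j < n.+2) (val d == j)); last by rewrite E.
rewrite big_split_ord /=.
by congr (_ + _); apply: eq_bigr => j _; rewrite /F /= ?modnDl modn_small.
Qed.

(* Since a group of even order has no complete mapping, the middle digit
   2 i is perturbed by a bit, which makes every difference occur twice. *)
Definition perturbed n (k : ('I_n.+2 * bool) * 'I_n.+2) (c : 'I_3) : 'I_n.+2 :=
  (k.2 + (k.1.1 *+ c + (k.1.2 && (c == 2 :> nat))%:R))%R.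

(** Between columns 0 and 1 the difference is i, between columns 1 and 2 it is i + b: either bit b
    gives each difference once. Between columns 0 and 2 it is 2 i + b, where only both bits together
    give each difference twice. *)
Lemma even_transversals n : resolvable_transversals (@perturbed n) 2.
Proof.
split=> [c d x y cd|k c]; last by move=> t t' /= /addIr.
wlog cd' : c d x y cd / c < d => [H|].
  have [lt|lt] := ltnP c d; first exact: H.
  have lt' : d < c by rewrite ltn_neqAle lt eq_sym cd.
  rewrite -(H d c y x _ lt') 1?eq_sym //; by apply: eq_bigr => k _; rewrite mulnC.
rewrite sum_pairE sum_pairE exchange_big big_bool /perturbed /=.
case: c d cd' {cd} => [[|[|[|c]]] hc] [[|[|[|d]]] hd] //= _; rewrite ?andbF ?andbT.
- have E : \sum_i \sum_j (x == j + (i *+ 0 + 0))%R * (y == j + (i *+ 1 + 0))%R = 1.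
    by apply: sum_shift_pairs => i i'; rewrite !mulr0n !addr0 !subr0.
  by rewrite !E.
- transitivity (\sum_(k : 'I_n.+2 * bool) ((y - x)%R == k.1 *+ 2 + k.2%:R)%R).
    2: exact: sum_eq_double.
  rewrite sum_pairE -big_split; apply: eq_bigr => i _; rewrite big_bool.
  have E b : \sum_j (x == j + (i *+ 0 + 0))%R * (y == j + (i *+ 2 + b))%R = (y - x == i *+ 2 + b)%R.
    rewrite (bigD1 x) //= big1 => [|j jx].
      by rewrite mulr0n !addr0 eqxx mul1n addn0 subr_eq [(_ + x)%R]addrC.
    by rewrite mulr0n !addr0 eq_sym (negPf jx).
  by rewrite !E.
- have E b : \sum_i \sum_j (x == j + (i *+ 1 + 0))%R * (y == j + (i *+ 2 + b))%R = 1.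
    apply: sum_shift_pairs => i i'; rewrite !mulr1n !mulr2n !addr0.
    by rewrite ![(_ + _ + b)%R]addrAC !addrK => /addIr.
  by rewrite !E.
Qed.

(** * Exchanging an octahedron *)

Definition double_edge (P : finType) (u v x y : P) : nat :=
  2 * ((x == u) * (y == v) + (x == v) * (y == u)).

(** The words of length 3 and even weight. Any two positions determine the third, so these are four
    faces of an octahedron that contain each of its edges once. *)
Definition parity_bits (b : bool * bool) (c : 'I_3) : bool :=
  nth false [:: b.1; b.2; b.1 (+) b.2] c.

Definition rung (V : finType) (u : 'I_3 -> bool -> V) (k : bool * 'I_3) : {set V * 'I_3} :=
  [set (u k.2 false, k.2); (u k.2 true, k.2); (u (k.2 + 1)%R k.1, (k.2 + 1)%R)].

Lemma succ3_neq (c : 'I_3) : c != (c + 1)%R.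
Proof. by case: c => [[|[|[|c]]] hc]. Qed.

Lemma cyclic3E (c : 'I_3) :
  ((c + 1 + 1 + 1)%R = c) *
  (((c == c + 1)%R = false) * ((c == c + 1 + 1)%R = false) * ((c + 1 == c)%R = false) *
  ((c + 1 == c + 1 + 1)%R = false) * ((c + 1 + 1 == c)%R = false) *
  ((c + 1 + 1 == c + 1)%R = false)).
Proof. by case: c => [[|[|[|c]]] hc] //; do !split=> //; apply: val_inj. Qed.

Lemma sum_cyclic3 (c : 'I_3) (F : 'I_3 -> nat) :
  \sum_d F d = F c + F (c + 1)%R + F (c + 1 + 1)%R.
Proof.
rewrite (bigD1 c) //= (bigD1 (c + 1)%R) ?cyclic3E //= (bigD1 (c + 1 + 1)%R) ?cyclic3E //=.
rewrite big1 ?addn0 ?addnA // => d; case: c d => [[|[|[|c]]] hc] [[|[|[|d]]] hd] //.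
Qed.

Lemma ind_cyclic3 (c d : 'I_3) : [\/ d = c, d = (c + 1)%R | d = (c + 1 + 1)%R].
Proof.
case: c d => [[|[|[|c]]] hc] [[|[|[|d]]] hd] //;
  by [apply: Or31; apply: val_inj|apply: Or32; apply: val_inj|apply: Or33; apply: val_inj].
Qed.

Lemma mem_rung (V : finType) (u : 'I_3 -> bool -> V) k x e :
  (forall c, u c false != u c true) ->
  ((x, e) \in rung u k) =
  (e == k.2) * ((x == u e false) + (x == u e true)) + (e == (k.2 + 1)%R) * (x == u e k.1) :> nat.
Proof.
move=> u_inj; case: k => b c /=.
rewrite mem_set3 ?xpair_eqE ?(negPf (u_inj c)) ?(negPf (succ3_neq c)) ?andbF //=.
rewrite -!mulnb mulnDr ![(x == _) * _]mulnC.
by congr (_ + _ + _); case: eqP => // ->.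
Qed.

(** An octahedron edge from column c to column c + 1 lies in the single rung chosen by its end in
    column c + 1, while the pair in column c lies in both rungs based there. *)
Lemma decomposes_rungs (V : finType) (u : 'I_3 -> bool -> V) :
  (forall c, u c false != u c true) ->
  decomposes (rung u) (fun x y =>
     if x.2 == y.2 then double_edge (u x.2 false) (u x.2 true) x.1 y.1
     else ((x.1 == u x.2 false) + (x.1 == u x.2 true)) *
          ((y.1 == u y.2 false) + (y.1 == u y.2 true))).
Proof.
move=> u_inj; split=> [[b c]|[x e] [y d] xy] /=.
  by rewrite set3_card ?xpair_eqE ?(negPf (u_inj c)) ?(negPf (succ3_neq c)) ?andbF.
rewrite /cross_cover sum_pairE big_bool !(sum_cyclic3 e) !mem_rung //= cyclic3E.
case: (ind_cyclic3 e d) xy => -> xy; rewrite ?cyclic3E ?eqxx /=.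
- have {}xy : x != y by apply: contra xy => /eqP->.
  have ux := u_inj e.
  have Nxy b : (x == u e b) * (y == u e b) = 0.
    by rewrite mulnb; case: eqP => // <-; rewrite eq_sym (negPf xy).
  move: (Nxy true) (Nxy false); rewrite /double_edge.
  by case: (x == _); case: (x == _); case: (y == _); case: (y == _).
- by case: (x == _); case: (x == _); case: (y == _); case: (y == _).
- by case: (x == _); case: (x == _); case: (y == _); case: (y == _).
Qed.

Lemma sum_parity_bits (V : finType) (u : 'I_3 -> bool -> V) (e d : 'I_3) x y :
  e != d ->
  \sum_b (x == u e (parity_bits b e)) * (y == u d (parity_bits b d)) =
  ((x == u e false) + (x == u e true)) * ((y == u d false) + (y == u d true)).
Proof.
rewrite sum_pairE big_bool !big_bool /parity_bits /=.
case: e d => [[|[|[|e]]] he] [[|[|[|d]]] hd] //= _;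
  case: (x == _); case: (x == _); case: (y == _); case: (y == _) => //.
Qed.

Lemma sum_setID (I : finType) (A B : {set I}) (F : I -> nat) : B \subset A ->
  \sum_i F i = \sum_(i | i \notin A) F i + \sum_(i in A :\: B) F i + \sum_(i in B) F i.
Proof.
move=> BA; rewrite (bigID (mem A)) /= addnC -addnA; congr (_ + _).
rewrite (big_setID B) /= addnC (setIidPr BA); congr (_ + _).
Qed.

(* The four transversals through the points [u c b] form an octahedron; it is
   exchanged for six triples that also cover the edges [u c false, u c true] twice. *)
Lemma exchanged_design (I V K : finType) (T : 'I_3 -> I -> {set V})
    (f : K * V -> 'I_3 -> V) (u : 'I_3 -> bool -> V) (s : bool * bool -> K * V) :
  (forall c, u c false != u c true) ->
  (forall c, decomposes (T c) (fun x y => 2 - double_edge (u c false) (u c true) x y)) ->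
  resolvable_transversals f 2 ->
  (forall b c, f (s b) c = u c (parity_bits b c)) ->
  injective (fun b => (s b).1) ->
  #|K| = 2 * #|V| -> 7 <= #|V| ->
  config_design (3 * #|V|) (2 * #|V|) (3 * #|V|).-1.
Proof.
move=> u_inj Tw fl fs s1i cK cV.
have s_inj : injective s by move=> b b' E; apply: s1i; rewrite E.
(* The exchange spoils the four classes in [bad]. Their surviving transversals, indexed by [L], join
   the further triples [R]; the other classes, indexed by [K'], stay intact. *)
pose bad := [set (s b).1 | b in [set: bool * bool]].
pose D := [set s b | b in [set: bool * bool]].
pose B := [set k : K * V | k.1 \in bad].
pose K' := {k : K | k \notin bad}.
pose L := {k : K * V | k \in B :\: D}.
have cK' : #|{: K'}| = #|K| - 4.
  rewrite card_sig; have := cardC bad.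
  rewrite (card_imset _ s1i) cardsT card_prod card_bool.
  by have -> : #|[predC bad]| = #|[pred x | x \notin bad]| by []; lia.
pose R : (I * 'I_3 + bool * 'I_3) + L -> {set V * 'I_3} :=
  sumf (sumf (fun k => in_column (T k.2 k.1) k.2) (rung u)) (fun k => cross_section (f (val k))).
pose C (k : K' * V) := cross_section (f (val k.1, k.2)).
(* With m = [#|V|] there remain 2 m - 4 classes, so q = m + 3; the condition q <= 2 m - 4 is the
   bound [7 <= #|V|]. *)
have -> : (3 * #|V|).-1 = #|V|.+3 + #|{: K'}| by rewrite cK'; lia.
apply: (@parallel_classes_design _ _ V (V * 'I_3)%type R C) => //.
- by rewrite card_prod card_ord mulnC.
- by rewrite cK'; lia.
- by rewrite cK'; lia.
- have cols := decomposes_columns Tw; have rungs := decomposes_rungs u_inj.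
  have trans := decomposes_cross_sections f.
  split=> [[[[k|k]|k]|k]|[x e] [y d] xy]; rewrite /R /C /=;
    rewrite ?card_cross_section ?card_ord ?cols.1 ?rungs.1 //.
  rewrite !cross_cover_sum cols.2 // rungs.2 //=.
  pose F k := (x == f k e) * (y == f k d).
  have sumC : cross_cover C C (x, e) (y, d) = \sum_(k | k \notin B) F k.
    rewrite /cross_cover sum_pairE.
    rewrite (eq_bigl (fun k : K * V => (k.1 \notin bad) && xpredT k.2)); last first.
      by move=> k; rewrite !inE andbT.
    rewrite (eq_bigr (fun k => F (k.1, k.2))); last by case.
    rewrite -(pair_big (fun k => k \notin bad) xpredT (fun k t => F (k, t))) /=.
    rewrite (big_sub [predC bad]); apply: eq_bigr => k _; apply: eq_bigr => t _.
    by rewrite !inE.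
  pose sectionL (k : L) := cross_section (f (val k)).
  have sumL : cross_cover sectionL sectionL (x, e) (y, d) = \sum_(k in B :\: D) F k.
    by rewrite (big_sub (B :\: D)); apply: eq_bigr => k _; rewrite !inE.
  have sumD : \sum_(k in D) F k = \sum_b F (s b).
    rewrite big_imset /=; last by move=> b b' _ _; exact: s_inj.
    by apply: eq_bigl => b; rewrite inE.
  have : \sum_k F k = if e == d then 0 else 2.
    case: eqP => [ed|/eqP ed]; last exact: fl.1.
    have tr := trans.2 (x, e) (y, d) xy; rewrite /= ed eqxx in tr; rewrite -[RHS]tr.
    by apply: eq_bigr => k _; rewrite !inE /F ed.
  rewrite (@sum_setID _ B D); last first.
    by apply/subsetP=> _ /imsetP[b _ ->]; rewrite inE; apply: imset_f.
  rewrite sumD sumL sumC; have [ed|ed] := eqVneq e d.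
    subst d.
    (* Subtraction is truncated; this bound lets the column triples and the rungs add up to 2. *)
    have : double_edge (u e false) (u e true) x y <= 2.
      rewrite /double_edge; have {}xy : x != y by apply: contra xy => /eqP->.
      have [->|_] := eqVneq x (u e false); last first.
        by case: (x == _); case: (y == _); case: (y == _).
      by rewrite (negPf (u_inj e)) addn0; case: (y == _).
    by lia.
  rewrite /F; under [X in _ + X = _ -> _]eq_bigr do rewrite !fs.
  by rewrite sum_parity_bits //; lia.
- move=> k y; exact: class_cross_sections fl.
Qed.

(** * Bose and Skolem triple systems *)

(** Stands for the unordered pairs of distinct elements, each listed in the order of [enum_rank]. *)
Definition upper_pair (Q : finType) := {p : Q * Q | enum_rank p.1 < enum_rank p.2}.

Lemma sum_upper_pair (Q : finType) (G : Q -> Q -> nat) :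
  \sum_(p : upper_pair Q) (G (val p).1 (val p).2 + G (val p).2 (val p).1) =
  \sum_a \sum_(b | b != a) G a b.
Proof.
transitivity (\sum_(p : Q * Q | enum_rank p.1 < enum_rank p.2) (G p.1 p.2 + G p.2 p.1)).
  by rewrite (big_sub [pred p : Q * Q | enum_rank p.1 < enum_rank p.2]).
rewrite big_split /=.
rewrite [X in _ + X](reindex_inj (h := fun p : Q * Q => (p.2, p.1))) /=.
  2: by case=> a b [c d] [-> ->].
rewrite pair_big_dep /= [RHS](bigID (fun p : Q * Q => enum_rank p.1 < enum_rank p.2)) /=.
congr (_ + _); apply: eq_big => -[a b] //=; rewrite -(inj_eq enum_rank_inj) -val_eqE /=; lia.
Qed.

Definition bose (Q : finType) (op : Q -> Q -> Q) (k : upper_pair Q * 'I_3) : {set Q * 'I_3} :=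
  let p := val k.1 in [set (p.1, k.2); (p.2, k.2); (op p.1 p.2, (k.2 + 1)%R)].

(* The cross pairs that the blocks of [bose op] leave uncovered. *)
Definition loop (Q : finType) (op : Q -> Q -> Q) (x y : Q * 'I_3) : nat :=
  (y.2 == x.2 + 1)%R * (y.1 == op x.1 x.1) + (x.2 == y.2 + 1)%R * (x.1 == op y.1 y.1).

Lemma upper_pair_neq (Q : finType) (p : upper_pair Q) : (val p).1 != (val p).2.
Proof. by case: p => -[a b] /= ab; apply: contraTN ab => /eqP->; rewrite ltnn. Qed.

Lemma mem_bose (Q : finType) (op : Q -> Q -> Q) k x e : let p := val k.1 in
  ((x, e) \in bose op k) =
  (e == k.2) * ((x == p.1) + (x == p.2)) + (e == (k.2 + 1)%R) * (x == op p.1 p.2) :> nat.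
Proof.
case: k => p c /=; have /negPf ab := upper_pair_neq p.
rewrite mem_set3 ?xpair_eqE ?ab ?(negPf (succ3_neq c)) ?andbF //=.
by rewrite -!mulnb mulnDr ![(x == _) * _]mulnC.
Qed.

(** A pair in one column is one unordered pair. For [x] in column c and [y] in column c + 1, the
    equation [op x b = y] has one solution b, and it yields a triple unless b = [x]. *)
Lemma decomposes_bose (Q : finType) (op : Q -> Q -> Q) :
  commutative op -> (forall a, injective (op a)) ->
  decomposes (bose op) (fun x y => 1 - loop op x y).
Proof.
move=> opC opI; split=> [[p c]|[x e] [y d] xy].
  by rewrite set3_card ?xpair_eqE ?(negPf (upper_pair_neq p)) ?(negPf (succ3_neq c)) ?andbF.
have cross (u v : Q) :
    \sum_(p : upper_pair Q) ((u == (val p).1) + (u == (val p).2)) *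
       (v == op (val p).1 (val p).2) = 1 - (v == op u u).
  transitivity (\sum_a \sum_(b | b != a) (u == a) * (v == op a b)).
    rewrite -sum_upper_pair; apply: eq_bigr => p _.
    by rewrite mulnDl [op (val p).2 _]opC.
  rewrite (bigD1 u) //= [X in _ + X]big1 ?addn0 => [|a au]; last first.
    by rewrite big1 // => b _; rewrite eq_sym (negPf au).
  rewrite -(sum_eq_inj v (opI u)) [in RHS](bigD1 u) //= addKn.
  by apply: eq_bigr => b _; rewrite eqxx mul1n.
rewrite /cross_cover sum_pairE exchange_big /= (sum_cyclic3 e).
under eq_bigr do rewrite !mem_bose /=.
under [X in _ + X + _]eq_bigr do rewrite !mem_bose /=.
under [X in _ + X]eq_bigr do rewrite !mem_bose /=.
rewrite /loop /= cyclic3E.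
case: (ind_cyclic3 e d) xy => -> xy; rewrite ?cyclic3E ?eqxx /=.
- have {}xy : x != y by apply: contra xy => /eqP->.
  have Nxy a : (x == a) * (y == a) = 0.
    by rewrite mulnb; case: eqP => // <-; rewrite eq_sym (negPf xy).
  rewrite [X in _ + X]big1 => [|p _]; last by rewrite !mul1n Nxy.
  rewrite [X in _ + X + _]big1 => [|p _]; last by rewrite !mul0n.
  transitivity (\sum_(a : Q) \sum_(b | b != a) (x == a) * (y == b)).
    rewrite -sum_upper_pair !addn0; apply: eq_bigr => p _.
    rewrite !mul0n !mul1n !addn0 mulnDl !mulnDr !Nxy add0n addn0.
    by rewrite [X in _ + X]mulnC.
  rewrite (bigD1 x) //= [X in _ + X]big1 ?addn0 => [|a au]; last first.
    by rewrite big1 // => b _; rewrite eq_sym (negPf au).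
  rewrite (bigD1 y) 1?eq_sym //= !eqxx big1 // => b /andP[_ /negPf yb].
  by rewrite [y == b]eq_sym yb muln0.
- rewrite [X in _ + X]big1 => [|p _]; last by rewrite !mul0n muln0.
  rewrite [X in _ + X + _]big1 => [|p _]; last by rewrite !mul0n.
  rewrite !mul0n !mul1n !addn0 -cross; apply: eq_bigr => p _.
  by rewrite !mul0n !mul1n addn0.
- rewrite [X in _ + X + _]big1 => [|p _]; last by rewrite !mul0n.
  rewrite big1 => [|p _]; last by rewrite !mul0n muln0.
  rewrite !mul0n !mul1n !add0n -cross; apply: eq_bigr => p _.
  by rewrite !mul0n !mul1n addn0 add0n mulnC.
Qed.

(** * Adjoining new points *)

Definition left_part (P Z : finType) (A : {set P}) : {set P + Z} :=
  [set z | if z is inl x then x \in A else false].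

Lemma decomposes_left (I P Z : finType) (T : I -> {set P}) w :
  decomposes T w ->
  decomposes (fun i => left_part Z (T i))
    (fun x y => match x, y with inl x, inl y => w x y | _, _ => 0 end).
Proof.
case=> T3 Tw; split=> [i|[x|z] [y|z'] xy].
- rewrite -card_sum_mem big_sumType /= [X in _ + X]big1 => [|z _]; last by rewrite inE.
  by rewrite addn0 -(T3 i) -card_sum_mem; apply: eq_bigr => x _; rewrite inE.
- by rewrite -Tw //; apply: eq_bigr => i _; rewrite !inE.
all: by rewrite /cross_cover big1 // => i _; rewrite !inE ?muln0.
Qed.

(** The edges from [(a z i, c)] to [(b z i, c + 1)] are joined to the new point [z]; they will be
    edges that the triples of [bose] leave uncovered. *)
Definition cone (Q Z I : finType) (a b : Z -> I -> Q) (k : (Z * I) * 'I_3) : {set Q * 'I_3 + Z} :=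
  let: (z, i, c) := k in [set inl (a z i, c); inl (b z i, (c + 1)%R); inr z].

Arguments cone : simpl never.

Lemma decomposes_cone (Q Z I : finType) (a b : Z -> I -> Q) :
  decomposes (cone a b)
    (fun x y => match x, y with
     | inl x, inl y =>
         (y.2 == x.2 + 1)%R * \sum_k (x.1 == a k.1 k.2) * (y.1 == b k.1 k.2) +
         (x.2 == y.2 + 1)%R * \sum_k (x.1 == b k.1 k.2) * (y.1 == a k.1 k.2)
     | inl x, inr z | inr z, inl x => \sum_i ((x.1 == a z i) + (x.1 == b z i))
     | inr _, inr _ => 0
     end).
Proof.
have neq z i c : (inl (a z i, c) : Q * 'I_3 + Z) != inl (b z i, (c + 1)%R).
  by apply/eqP=> -[_ /eqP]; rewrite (negPf (succ3_neq c)).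
have memE k x e : (inl (x, e) \in cone a b k) =
   (e == k.2) * (x == a k.1.1 k.1.2) + (e == (k.2 + 1)%R) * (x == b k.1.1 k.1.2) :> nat.
  case: k => -[z i] c; rewrite mem_set3 ?neq //= addn0.
  by rewrite !mulnb; congr (nat_of_bool _ + nat_of_bool _); rewrite andbC.
have memz k z : (inr z \in cone a b k) = (z == k.1.1).
  by case: k => -[z' i] c; rewrite !inE.
have mixed x e z : cross_cover (cone a b) (cone a b) (inl (x, e)) (inr z) =
    \sum_i ((x == a z i) + (x == b z i)).
  rewrite /cross_cover sum_pairE sum_pairE (bigD1 z) //= [X in _ + X]big1 => [|z' zz].
    rewrite addn0; apply: eq_bigr => i _; rewrite (sum_cyclic3 e) !memE !memz /=.
    by rewrite !cyclic3E !eqxx !mul0n !mul1n !muln1 !addn0.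
  rewrite big1 // => i _; rewrite big1 // => c _.
  by rewrite memz /= eq_sym (negPf zz) muln0.
split=> [[[z i] c]|[[x e]|z] [[y d]|z'] xy].
- by rewrite set3_card ?neq.
- rewrite /cross_cover sum_pairE /=.
  under eq_bigr do rewrite (sum_cyclic3 e) !memE /= ?cyclic3E.
  case: (ind_cyclic3 e d) xy => -> xy; rewrite ?cyclic3E ?eqxx.
  + have {}xy : x != y by apply: contra xy => /eqP->.
    rewrite !mul0n big1 // => k _.
    have Nxy u : (x == u) * (y == u) = 0.
      by rewrite mulnb; case: eqP => // <-; rewrite eq_sym (negPf xy).
    by rewrite !mul1n !mul0n !addn0 !add0n !Nxy.
  + rewrite mul0n mul1n addn0; apply: eq_bigr => k _.
    by rewrite !mul1n !mul0n !addn0 !add0n !muln0 ?addn0.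
  + rewrite mul0n mul1n add0n; apply: eq_bigr => k _.
    by rewrite !mul1n !mul0n !addn0 !add0n !muln0 ?add0n.
- exact: mixed.
- by rewrite cross_coverC mixed.
- rewrite /cross_cover big1 // => k _; rewrite !memz mulnb.
  have [Ez|//] := eqVneq z k.1.1; have [Ez'|//] := eqVneq z' k.1.1.
  by rewrite Ez Ez' eqxx in xy.
Qed.

(** * Quasigroups and the resulting triple systems *)

Definition has_triple_system n l :=
  exists (P I : finType) (T : I -> {set P}), #|P| = n /\ triple_system T l.

Lemma double_inj_ord n : odd n.+1 -> injective (fun x : 'I_n.+1 => x + x)%R.
Proof.
have modE s : s < n.+1 + n.+1 -> s %% n.+1 = if s < n.+1 then s else s - n.+1.
  move=> s2; case: ltnP => [/modn_small-> //|ns]; rewrite -{1}(subnK ns) modnDr modn_small //; lia.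
move=> n_odd x y /(congr1 val) /=; have := ltn_ord x; have := ltn_ord y => yn xn.
rewrite !modE; try lia.
by case: (ltnP (x + x)); case: (ltnP (y + y)) => ? ? E; apply: val_inj => /=; lia.
Qed.

(** The mean (a + b) / 2, since 2 is invertible modulo an odd q. *)
Lemma idempotent_quasigroup q : odd q ->
  exists op : 'I_q -> 'I_q -> 'I_q,
    [/\ commutative op, forall a, injective (op a) & forall a, op a a = a].
Proof.
case: q => // q q_odd; have hi := double_inj_ord q_odd.
exists (fun a b => invF hi (a + b)%R); split=> [a b|a b b' /(can_inj (f_invF hi))|a].
- by rewrite addrC.
- by move=> /addrI.
- by rewrite (invF_f hi).
Qed.

(** Arguments (i, b) are read as i + b k modulo 2 k, but a sum s is decoded by its half and its
    parity. Doubling i or i + k gives 2 i, decoded as (i, false). *)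
Lemma half_idempotent_quasigroup k :
  exists op : 'I_k * bool -> 'I_k * bool -> 'I_k * bool,
    [/\ commutative op, forall a, injective (op a) & forall a, op a a = (a.1, false)].
Proof.
case: k => [|k]; first by exists (fun a _ => a); split=> [[[]]|[[]]|[[]]].
pose n := k.+1.*2.
pose code (a : 'I_k.+1 * bool) := a.1 + a.2 * k.+1.
have code_lt a : code a < n by rewrite /code /n; case: a => -[i /= hi] []; lia.
have code_inj : injective code.
  move=> [i b] [j c]; rewrite /code /= => E.
  have [hi hj] := (ltn_ord i, ltn_ord j).
  have bc : b = c by case: b c E => -[] //=; lia.
  by subst c; congr (_, _); apply: val_inj => /=; lia.
pose op a b := let s := (code a + code b) %% n in (inord s./2 : 'I_k.+1, odd s).
have dec s t : s < n -> t < n ->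
    (inord s./2 : 'I_k.+1, odd s) = (inord t./2, odd t) -> s = t.
  rewrite /n => sn tn [] /(congr1 val); rewrite /= !inordK; lia.
exists op; split=> [a b|a b b' E|a].
- by rewrite /op addnC.
- apply: code_inj.
  have : code a + code b == code a + code b' %[mod n].
    by apply/eqP/dec; rewrite ?ltn_pmod.
  by rewrite eqn_modDl !modn_small // => /eqP.
- rewrite /op /code /n; case: a => i b /=.
  have -> : (i + b * k.+1 + (i + b * k.+1)) %% k.+1.*2 = i.*2.
    have hi := ltn_ord i; rewrite addnn doubleD doubleMr; case: b.
      by rewrite mul1n modnDr modn_small // ltn_double.
    by rewrite mul0n addn0 modn_small // ltn_double.
  by rewrite doubleK odd_double inord_val.
Qed.

(** Bose's construction: by idempotency the uncovered pairs lie over a single element a, and the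
    constant section at a covers them. *)
Lemma has_steiner_triple_system_3q q : odd q -> has_triple_system (3 * q) 1.
Proof.
move=> /idempotent_quasigroup[op [opC opI opE]].
exists ('I_q * 'I_3)%type, (upper_pair 'I_q * 'I_3 + 'I_q)%type,
  (sumf (bose op) (fun a => cross_section (fun=> a))).
split; first by rewrite card_prod !card_ord mulnC.
apply: eq_decomposes (decomposes_sum (decomposes_bose opC opI)
  (decomposes_cross_sections (fun a (_ : 'I_3) => a))) _.
move=> [x e] [y d] xy; rewrite /loop /= !opE.
have -> : \sum_a (x == a) * (y == a) = (x == y).
  rewrite (bigD1 x) //= eqxx mul1n big1 ?addn0 1?eq_sym // => a /negPf ax.
  by rewrite eq_sym ax.
rewrite [y == x]eq_sym; case: (ind_cyclic3 e d) xy => -> xy; rewrite ?cyclic3E ?eqxx;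
  by case: (x == y).
Qed.

Lemma sum_delta (P : finType) x (F : P -> nat) : \sum_a (x == a) * F a = F x.
Proof.
rewrite (bigD1 x) //= eqxx mul1n big1 ?addn0 // => a /negPf ax.
by rewrite eq_sym ax.
Qed.

(** Two copies of Bose's triples; on the three points over each a together with the new point, all
    four triples are added, a TS(4, 2). *)
Lemma has_triple_system_3q1 q : odd q -> has_triple_system (3 * q).+1 2.
Proof.
move=> /idempotent_quasigroup[op [opC opI opE]].
pose id_apex (z : unit) (a : 'I_q) := a.
exists ('I_q * 'I_3 + unit)%type, _,
  (sumf (fun i => left_part unit
           (sumf (sumf (bose op) (bose op)) (fun a => cross_section (fun=> a)) i))
    (cone id_apex id_apex)).
split; first by rewrite card_sum card_prod !card_ord card_unit addn1 mulnC.
apply: eq_decomposes (decomposes_sum (decomposes_left unit (decomposes_sum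
   (decomposes_sum (decomposes_bose opC opI) (decomposes_bose opC opI))
   (decomposes_cross_sections (fun a (_ : 'I_3) => a)))) (decomposes_cone id_apex id_apex)) _.
have mixed z (x : 'I_q) : \sum_i ((x == id_apex z i) + (x == id_apex z i)) = 2.
  by rewrite big_split /= (sum_eq_inj x (@inj_id _)).
move=> [[x e]|z] [[y d]|z'] xy; [|exact: mixed|exact: mixed|by case: z z' xy => -[] []]; rewrite /=.
have loopE : \sum_k (x == id_apex k.1 k.2) * (y == id_apex k.1 k.2) = (x == y).
  by rewrite (sum_pair2 _ (fun a => (x == a) * (y == a))) card_unit mul1n sum_delta eq_sym.
rewrite /loop /= !opE loopE sum_delta.
rewrite [y == x]eq_sym; case: (ind_cyclic3 e d) xy => -> xy; rewrite ?cyclic3E ?eqxx;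
  by case: (x == y).
Qed.

(** Skolem's construction: uncovered edges run from (w, b) in column c to (w, false) in column c +
    1. For b = false they form the constant sections, for b = true they are joined to the new point,
    which meets each point once. *)
Lemma has_steiner_triple_system_6k1 k : has_triple_system (6 * k).+1 1.
Proof.
have [op [opC opI opE]] := half_idempotent_quasigroup k.
pose a (z : unit) (w : 'I_k) := (w, true); pose b (z : unit) (w : 'I_k) := (w, false).
exists (('I_k * bool) * 'I_3 + unit)%type, _,
  (sumf (fun i => left_part unit
           (sumf (bose op) (fun w : 'I_k => cross_section (fun=> (w, false))) i))
    (cone a b)).
split; first by rewrite card_sum !card_prod !card_ord card_unit card_bool; lia.
apply: eq_decomposes (decomposes_sum (decomposes_left unit (decomposes_sum
   (decomposes_bose opC opI)
   (decomposes_cross_sections (fun (w : 'I_k) (_ : 'I_3) => (w, false))))) (decomposes_cone a b)) _.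
have deltaE c c' (x : 'I_k * bool) : \sum_w (x == (w, c)) * c' w = (x.2 == c) * c' x.1.
  rewrite -(sum_delta x.1 (fun w => (x.2 == c) * c' w)); apply: eq_bigr => w _.
  by rewrite mulnA -[X in nat_of_bool X]xpair_eqE mulnb; case: x.
have mixed z (x : 'I_k * bool) : \sum_i ((x == a z i) + (x == b z i)) = 1.
  rewrite big_split /= /a /b.
  under eq_bigr do rewrite -[nat_of_bool _]muln1.
  under [X in _ + X]eq_bigr do rewrite -[nat_of_bool _]muln1.
  by rewrite (deltaE _ (fun=> 1)) (deltaE _ (fun=> 1)); case: x => w [].
move=> [[x e]|z] [[y d]|z'] xy; [|exact: mixed|exact: mixed|by case: z z' xy => -[] []]; rewrite /=.
have sumE (x' y' : 'I_k * bool) : \sum_k0 (x' == a k0.1 k0.2) * (y' == b k0.1 k0.2) =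
    (x'.2 == true) * (y' == (x'.1, false)).
  rewrite (sum_pair2 _ (fun w => (x' == (w, true)) * (y' == (w, false)))).
  by rewrite card_unit mul1n (deltaE _ (fun w => (y' == (w, false) : nat))).
have sumE' (x' y' : 'I_k * bool) : \sum_k0 (x' == b k0.1 k0.2) * (y' == a k0.1 k0.2) =
    (y'.2 == true) * (x' == (y'.1, false)).
  by rewrite -sumE; apply: eq_bigr => ? _; exact: mulnC.
rewrite /loop /= !opE sumE sumE' (deltaE _ (fun w => (y == (w, false) : nat))).
case: (ind_cyclic3 e d) xy => -> xy; rewrite ?cyclic3E ?eqxx.
- by [].
- by case: x y {xy} => w [] [w' []] /=; rewrite !xpair_eqE ?andbF ?andbT //; case: (_ == _).
- by case: x y {xy} => w [] [w' []] /=; rewrite !xpair_eqE ?andbF ?andbT // eq_sym; case: (_ == _).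
Qed.

Definition flipped (W : Type) (op : W * bool -> W * bool -> W * bool) x y :=
  ((op x y).1, ~~ (op x y).2).

(** The diagonals are (w, false) and (w, true), so the two families together miss exactly once every
    pair in distinct columns over the same w: an octahedron for each w. *)
Lemma decomposes_bose_flipped (W : finType) (op : W * bool -> W * bool -> W * bool) :
  commutative op -> (forall a, injective (op a)) -> (forall a, op a a = (a.1, false)) ->
  decomposes (sumf (bose op) (bose (flipped op)))
    (fun x y => 2 - ((y.2 == x.2 + 1)%R + (x.2 == y.2 + 1)%R) * (x.1.1 == y.1.1)).
Proof.
move=> opC opI opE.
apply: eq_decomposes (decomposes_sum (decomposes_bose opC opI) (decomposes_bose _ _)) _.
- by move=> x y; rewrite /flipped opC.
- move=> a b b' [E1 /negb_inj E2]; apply: (opI a).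
  by case: (op a b) (op a b') E1 E2 => ? ? [? ?] /= -> ->.
move=> [x e] [y d] xy; rewrite /loop /flipped /= !opE /=.
case: (ind_cyclic3 e d) xy => -> xy; rewrite ?cyclic3E ?eqxx.
- by [].
- case: x y {xy} => w [] [w' []]; rewrite !xpair_eqE ?andbF ?andbT ?[w' == w]eq_sym;
    by case: (w == w').
- case: x y {xy} => w [] [w' []]; rewrite !xpair_eqE ?andbF ?andbT ?[w' == w]eq_sym;
    by case: (w == w').
Qed.

(** The missing octahedron over each w is covered by its four faces of even parity. *)
Lemma has_triple_system_6k k : has_triple_system (6 * k) 2.
Proof.
have [op [opC opI opE]] := half_idempotent_quasigroup k.
pose face (i : 'I_k * (bool * bool)) (c : 'I_3) := (i.1, parity_bits i.2 c).
exists (('I_k * bool) * 'I_3)%type, _,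
  (sumf (sumf (bose op) (bose (flipped op))) (fun i => cross_section (face i))).
split; first by rewrite !card_prod !card_ord card_bool; lia.
apply: eq_decomposes (decomposes_sum (decomposes_bose_flipped opC opI opE)
  (decomposes_cross_sections face)) _.
move=> [[x b] e] [[y c] d] xy /=.
have faceE : e != d -> \sum_i ((x, b) == face i e) * ((y, c) == face i d) = (x == y).
  move=> ed; rewrite sum_pairE.
  transitivity (\sum_w (x == w) * (y == w)); last by rewrite sum_delta eq_sym.
  apply: eq_bigr => w _; rewrite -[RHS]muln1.
  have <- : \sum_s (b == parity_bits s e) * (c == parity_bits s d) = 1.
    by rewrite (sum_parity_bits (fun _ => id)) //; case: b c {xy} => -[].
  by rewrite big_distrr; apply: eq_bigr => s _; rewrite /= /face !xpair_eqE -!mulnb mulnACA.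
move: faceE; case: (ind_cyclic3 e d) xy => -> xy; rewrite ?cyclic3E ?eqxx //.
  by move=> ->//; case: (_ == _).
by move=> ->//; case: (_ == _).
Qed.

(** Of the missing octahedron edges, one new point takes those that preserve the bit and the other
    those that change it. Each new point then meets every old point twice, and the two never
    meet. *)
Lemma double_edge_packing k :
  exists (P I : finType) (u v : P) (T : I -> {set P}),
    [/\ #|P| = (6 * k).+2, u != v & decomposes T (fun x y => 2 - double_edge u v x y)].
Proof.
have [op [opC opI opE]] := half_idempotent_quasigroup k.
pose a (z : bool) (x : 'I_k * bool) := x.
pose b (z : bool) (x : 'I_k * bool) := (x.1, x.2 (+) z).
exists (('I_k * bool) * 'I_3 + bool)%type, _, (inr false), (inr true),
  (sumf (fun i => left_part bool (sumf (bose op) (bose (flipped op)) i)) (cone a b)).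
split=> //; first by rewrite card_sum !card_prod !card_ord card_bool; lia.
apply: eq_decomposes (decomposes_sum
  (decomposes_left bool (decomposes_bose_flipped opC opI opE)) (decomposes_cone a b)) _.
have mixed z x : \sum_i ((x == a z i) + (x == b z i)) = 2.
  rewrite big_split /= (sum_eq_inj x (@inj_id _)) (sum_eq_inj x (h := b z)) //.
  by move=> [w c] [w' c'] [-> /addIb->].
have sumE x y : \sum_i (x == a i.1 i.2) * (y == b i.1 i.2) = (x.1 == y.1).
  rewrite sum_pairE big_bool /= /a !(sum_delta x (fun i => (y == (i.1, i.2 (+) _)))).
  case: x y => w [] [w' []]; rewrite !xpair_eqE /= ?andbF ?andbT eq_sym; by case: (_ == _).
have sumE' x y : \sum_i (x == b i.1 i.2) * (y == a i.1 i.2) = (x.1 == y.1).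
  rewrite eq_sym -sumE; apply: eq_bigr => ? _; exact: mulnC.
move=> [[x e]|z] [[y d]|z'] xy; rewrite /double_edge /= ?muln0 ?subn0.
- rewrite sumE sumE'.
  case: (ind_cyclic3 e d) xy => -> xy; rewrite ?cyclic3E ?eqxx //;
    by case: (_ == _).
- exact: mixed.
- exact: mixed.
- by case: z z' xy => -[].
Qed.

(** * Designs invariant under Z_m x Z_m *)

Definition sheared (V : finZmodType) (J K : finType) (f : K -> 'I_3 -> V)
    (B : J -> {set V * 'I_3}) (k : J * K) : {set V * 'I_3} :=
  [set z | ((z.1 - f k.2 z.2)%R, z.2) \in B k.1].

Definition column_count (V : finType) (B : {set V * 'I_3}) (c : 'I_3) : nat :=
  \sum_x ((x, c) \in B).

Lemma card_sheared (V : finZmodType) (J K : finType) (f : K -> 'I_3 -> V)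
    (B : J -> {set V * 'I_3}) k :
  #|sheared f B k| = #|B k.1|.
Proof.
rewrite (_ : sheared f B k = (fun z => ((z.1 - f k.2 z.2)%R, z.2)) @^-1: B k.1); last first.
  by apply/setP=> z; rewrite !inE.
apply: card_preim_bij; exists (fun z => ((z.1 + f k.2 z.2)%R, z.2)) => -[x c] /=;
  by rewrite ?addrK ?subrK.
Qed.

(** A point of [B j] in column [e] and one of [B' j] in column [d] are moved onto [x] and [y] by
    exactly one [k], so only column counts matter. *)
Lemma sheared_cover (V : finZmodType) (J K : finType) (f f' : K -> 'I_3 -> V)
    (B B' : J -> {set V * 'I_3}) e d x y :
  (forall x y, \sum_k (x == f k e) * (y == f' k d) = 1) ->
  cross_cover (sheared f B) (sheared f' B') (x, e) (y, d) =
  \sum_j column_count (B j) e * column_count (B' j) d.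
Proof.
move=> ff; rewrite /cross_cover sum_pairE; apply: eq_bigr => j _.
transitivity (\sum_k \sum_(z : V * V) (((x - z.1)%R == f k e) * ((y - z.2)%R == f' k d)) *
   (((z.1, e) \in B j) * ((z.2, d) \in B' j))).
  apply: eq_bigr => k _; rewrite !inE /=.
  rewrite -(sum_delta ((x - f k e)%R, (y - f' k d)%R)
    (fun z => ((z.1, e) \in B j) * ((z.2, d) \in B' j))).
  apply: eq_bigr => -[z z'] _; congr (_ * _); rewrite mulnb xpair_eqE /=.
  by rewrite !subr_eq [(z + _)%R]addrC [(z' + _)%R]addrC.
rewrite exchange_big /= sum_pairE big_distrl; apply: eq_bigr => z _.
rewrite big_distrr; apply: eq_bigr => z' _ /=.
by rewrite -big_distrl /= ff mul1n.
Qed.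

Lemma sheared_cover_column (V : finZmodType) (J K : finType) (f : K -> 'I_3 -> V)
    (B : J -> {set V * 'I_3}) e m x y :
  (forall x, \sum_k (x == f k e) = m) ->
  cross_cover (sheared f B) (sheared f B) (x, e) (y, e) =
  m * \sum_j \sum_z ((z, e) \in B j) * ((z + (y - x), e)%R \in B j).
Proof.
move=> fm; rewrite /cross_cover sum_pairE big_distrr; apply: eq_bigr => j _ /=.
transitivity (\sum_k \sum_z ((x - z)%R == f k e) *
  (((z, e) \in B j) * ((z + (y - x), e)%R \in B j))).
  apply: eq_bigr => k _; rewrite !inE /=.
  have -> : (y - f k e = x - f k e + (y - x))%R by rewrite [RHS]addrC subrKA.
  rewrite -(sum_delta (x - f k e)%R (fun z => ((z, e) \in B j) * ((z + (y - x), e)%R \in B j))).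
  by apply: eq_bigr => z _; congr (_ * _); rewrite !subr_eq [(z + _)%R]addrC.
rewrite exchange_big /= big_distrr; apply: eq_bigr => z _.
by rewrite -big_distrl /= fm.
Qed.

Lemma sum_bool_halves (G : bool -> nat) k : \sum_(i < k.*2) G (odd i) = k * (G false + G true).
Proof.
elim: k => [|k IHk]; first by rewrite big_ord0.
by rewrite doubleS !big_ord_recr /= IHk odd_double /= mulSn; lia.
Qed.

Lemma half_system h (d : 'I_h.*2.+1) : d != 0%R ->
  \sum_(i < h) ((d == inord i.+1) + (d == - inord i.+1)%R) = 1.
Proof.
move=> d0; have hd := ltn_ord d.
have {}d0 : 0 < d by rewrite lt0n; apply: contra d0 => /eqP E; apply/eqP/val_inj.
have sum_lt (w : nat) : \sum_(i < h) (w == i) = (w < h).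
  have [wh|hw] := ltnP w h; last by rewrite big1 // => i _; have hi := ltn_ord i; lia.
  by rewrite -[RHS](sum_eq1 (Ordinal wh)); apply: eq_bigr => i _; rewrite eq_sym.
rewrite big_split /=.
rewrite (eq_bigr (fun i : 'I_h => (d.-1 == i) : nat)) => [|i _]; last first.
  by have hi := ltn_ord i; rewrite -val_eqE /= inordK; [congr nat_of_bool; lia|lia].
rewrite [X in _ + X](eq_bigr (fun i : 'I_h => (h.*2 - d == i) : nat)) => [|i _]; last first.
  have hi := ltn_ord i; rewrite -val_eqE /= inordK; last by lia.
  by rewrite modn_small; [congr nat_of_bool; lia|lia].
rewrite !sum_lt; lia.
Qed.

Lemma ord_mulrn_eq0 n k (x : 'I_n.+1) : coprime n.+1 6 -> 0 < k < 5 -> (x *+ k = 0)%R -> x = 0%R.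
Proof.
move=> n6 k5; have nk : coprime n.+1 k.
  (* Each of 1, 2, 3, 4 divides 36, which is prime to the modulus. *)
  apply: (@coprime_dvdr k (6 * 6)); last by rewrite coprimeMr n6.
  by case: k k5 => [|[|[|[|[|k]]]]].
rewrite Zp_mulrn => /(congr1 val) /= /eqP; rewrite -[_ == _]/(n.+1 %| x * k) Gauss_dvdl //.
by rewrite /dvdn modn_small // => /eqP E; apply: val_inj.
Qed.

(** The sum of the two truncated differences is the absolute value of the determinant; between 1 and
    4 it is a unit, so the linear map is injective. *)
Lemma sum_linear_forms n (x y : 'I_n.+1) a b a' b' :
  coprime n.+1 6 -> 0 < (a * b' - a' * b) + (a' * b - a * b') < 5 ->
  \sum_(k : 'I_n.+1 * 'I_n.+1)
    (x == k.1 *+ a + k.2 *+ b)%R * (y == k.1 *+ a' + k.2 *+ b')%R = 1.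
Proof.
move=> n6 D5; apply: (@sum_pair_eq_inj _ _ (fun k : 'I_n.+1 * 'I_n.+1 =>
  (k.1 *+ a + k.2 *+ b, k.1 *+ a' + k.2 *+ b')%R)).
have key (z : 'I_n.+1) : (z *+ (a * b') = z *+ (a' * b) -> z = 0)%R.
  move=> E; apply: (ord_mulrn_eq0 n6 D5); have [le|lt] := leqP (a * b') (a' * b).
    apply: (addrI (z *+ (a * b'))%R); rewrite addr0 -mulrnDr [RHS]E; congr (_ *+ _)%R; lia.
  apply: (addrI (z *+ (a' * b))%R); rewrite addr0 -mulrnDr -[RHS]E; congr (_ *+ _)%R; lia.
move=> [s t] [s' t'] E.
have {E} [E1 E2] := (congr1 fst E, congr1 snd E); rewrite /= in E1 E2.
have D1 : ((s - s') *+ a = - ((t - t') *+ b))%R.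
  apply/eqP; rewrite -addr_eq0 !mulrnBl addrACA -opprD E1 subrr //.
have D2 : ((s - s') *+ a' = - ((t - t') *+ b'))%R.
  apply/eqP; rewrite -addr_eq0 !mulrnBl addrACA -opprD E2 subrr //.
have es : (s - s' = 0)%R.
  by apply: key; rewrite !mulrnA D1 D2 !mulNrn -!mulrnA mulnC.
have et : (t - t' = 0)%R.
  apply: key; rewrite [a * _]mulnC [a' * _]mulnC !mulrnA.
  by apply: oppr_inj; rewrite -[LHS]mulNrn -[RHS]mulNrn -D1 -D2 -!mulrnA mulnC.
by congr (_, _); apply/eqP; rewrite -subr_eq0; apply/eqP.
Qed.

Definition slope (b : bool) (c : 'I_3) : nat * nat :=
  if b then nth (0, 0) [:: (1, 2); (2, 1); (3, 2)] c
  else nth (0, 0) [:: (1, 0); (0, 1); (1, 1)] c.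

(* The six columns move along six directions of Z_m^2 whose pairwise determinants
   are 1, 2, 3 or 4 up to sign, hence units when m is coprime to 6. *)
Definition slide n (b : bool) (k : 'I_n.+1 * 'I_n.+1) (c : 'I_3) : 'I_n.+1 :=
  (k.1 *+ (slope b c).1 + k.2 *+ (slope b c).2)%R.

Lemma sum_slide n b b' c d (x y : 'I_n.+1) : coprime n.+1 6 -> (b, c) != (b', d) ->
  \sum_k (x == slide b k c) * (y == slide b' k d) = 1.
Proof.
move=> n6 ne; apply: sum_linear_forms => //.
by case: b b' c d ne => [] [] [[|[|[|c]]] hc] [[|[|[|d]]] hd].
Qed.

Lemma sum_slide1 n b c (x : 'I_n.+1) : coprime n.+1 6 ->
  \sum_k (x == slide b k c) = n.+1.
Proof.
move=> n6; transitivity (\sum_(y : 'I_n.+1) \sum_k (x == slide b k c) * (y == slide (~~ b) k c)).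
  rewrite exchange_big; apply: eq_bigr => k _.
  by rewrite -big_distrr /= sum_eq1 muln1.
rewrite (eq_bigr (fun=> 1)) => [|y _]; first by rewrite sum_nat_const card_ord muln1.
by apply: sum_slide => //; case: b.
Qed.

(** A Bose triple up to translation inside the columns; its only difference within a column is [d],
    up to sign. *)
Definition fork (V : finZmodType) (c a : 'I_3) (d : V) : {set V * 'I_3} :=
  [set (0%R, c); (d, c); (0%R, a)].

Lemma mem_fork (V : finZmodType) (c a : 'I_3) (d : V) x e : c != a -> d != 0%R ->
  ((x, e) \in fork c a d) = (e == c) * ((x == 0%R) + (x == d)) + (e == a) * (x == 0%R) :> nat.
Proof.
move=> ca d0; have n0d : (0 == d)%R = false by rewrite eq_sym (negPf d0).
rewrite mem_set3 ?xpair_eqE ?n0d ?(negPf ca) ?andbF // -!mulnb.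
by rewrite mulnDr ![(x == _) * _]mulnC.
Qed.

Lemma column_count_fork (V : finZmodType) (c a e : 'I_3) (d : V) : c != a -> d != 0%R ->
  column_count (fork c a d) e = (e == c) * 2 + (e == a).
Proof.
move=> ca d0; rewrite /column_count; under eq_bigr do rewrite mem_fork //.
by rewrite big_split -!big_distrr big_split /= !sum_eq1 muln1.
Qed.

Lemma fork_differences (V : finZmodType) (c a e : 'I_3) (d r : V) :
  c != a -> d != 0%R -> r != 0%R ->
  \sum_z ((z, e) \in fork c a d) * ((z + r, e)%R \in fork c a d) =
  (e == c) * ((r == d) + (r == - d)%R).
Proof.
move=> ca d0 r0; under eq_bigr do rewrite !mem_fork //.
have nn z : (z == 0)%R * (z + r == 0)%R = 0.
  by rewrite mulnb; case: eqP => // ->; rewrite add0r (negPf r0).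
have [->|ec] := eqVneq e c.
  rewrite (negPf ca); under eq_bigr do rewrite !mul1n !mul0n !addn0.
  transitivity (\sum_z ((0%R == z) * (z + r == d)%R + (d == z) * (z + r == 0)%R)).
    apply: eq_bigr => z _; rewrite mulnDl !mulnDr nn add0n [(0 == z)%R]eq_sym [d == z]eq_sym.
    rewrite -[RHS]addn0 -[RHS]addnA; congr (_ + (_ + _)).
    by rewrite mulnb; case: eqP => // ->; rewrite -[X in _ == X]addr0 (inj_eq (addrI _)) (negPf r0).
  by rewrite big_split /= !sum_delta add0r mul1n addrC addr_eq0.
by rewrite big1 // => z _; rewrite !mul0n !add0n mulnACA nn muln0.
Qed.

(** Put m = 2 h + 1. In a column, the rotations of the forks give each nonzero difference once, and
    each translation occurs m times. Between columns of one group every step gives 2 and the zero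
    section 1, in all m. Across the groups the balance hypothesis gives 3 h, and the zero section
    adds 1. *)
Lemma slid_forks_design h (g s : 'I_h -> 'I_3) :
  coprime h.*2.+1 6 ->
  (forall i, s i != 0%R) ->
  (forall e d : 'I_3, \sum_i \sum_c ((e == c) * 2 + (e == c + 1)%R) *
     ((d == c + g i)%R * 2 + (d == c + g i + s i)%R) = 3 * h) ->
  config_design (3 * h.*2.+1) h.*2.+1 (3 * h).+1.
Proof.
move=> n6 s0 bal; pose V := 'I_h.*2.+1; pose dd (i : 'I_h) : V := inord i.+1.
have dd0 i : dd i != 0%R by have hi := ltn_ord i; rewrite -val_eqE /= inordK //; lia.
pose B (g s : 'I_h -> 'I_3) : 'I_h * 'I_3 + unit -> {set V * 'I_3} :=
  sumf (fun j => fork (j.2 + g j.1)%R (j.2 + g j.1 + s j.1)%R (dd j.1))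
       (fun=> cross_section (fun=> 0%R)).
have neq (t : 'I_h -> 'I_3) i (c : 'I_3) : t i != 0%R -> c != (c + t i)%R.
  by apply: contra => /eqP E; apply/eqP/(addrI c); rewrite addr0 -E.
have B3 g' s' j : (forall i, s' i != 0%R) -> #|B g' s' j| = 3.
  move=> s0'; case: j => [[i c]|[]] /=; last by rewrite card_cross_section card_ord.
  by rewrite set3_card // xpair_eqE ?(negPf (neq _ _ _ (s0' i))) ?andbF // eq_sym negb_and dd0.
have cc g' s' e : (forall i, s' i != 0%R) -> forall j, column_count (B g' s' j) e =
   match j with inl j => (e == j.2 + g' j.1)%R * 2 + (e == j.2 + g' j.1 + s' j.1)%R | _ => 1 end.
  move=> s0' [[i c]|[]] /=; first by rewrite column_count_fork // neq.
  by rewrite /column_count; under eq_bigr do rewrite inE /=; rewrite sum_eq1.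
have shift3 (F : 'I_3 -> nat) (t : 'I_3) : \sum_c F (c + t)%R = \sum_c F c.
  by rewrite [RHS](reindex_inj (addIr t)).
have TS b g' s' : (forall i, s' i != 0%R) -> triple_system (sheared (@slide _ b) (B g' s')) h.*2.+1.
  move=> s0'; split=> [k|[x e] [y d] xy]; first by rewrite card_sheared B3.
  have [ed|ed] := eqVneq e d.
    subst d; have {}xy : x != y by apply: contra xy => /eqP->.
    rewrite (sheared_cover_column _ _ _ (fun x => sum_slide1 b e x n6)).
    rewrite -[RHS]muln1; congr (_ * _); rewrite big_sumType sum_pairE /=.
    rewrite [X in _ + X]big1 => [|u _]; last first.
      rewrite big1 // => z _; rewrite !inE /= mulnb; case: eqP => // ->.
      by rewrite add0r subr_eq0 eq_sym (negPf xy).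
    have yx0 : (y - x != 0)%R by rewrite subr_eq0 eq_sym.
    rewrite addn0 -[RHS](half_system yx0); apply: eq_bigr => i _.
    under eq_bigr do rewrite fork_differences ?neq //.
    by rewrite -big_distrl /= (shift3 (fun c => (e == c) : nat)) (sum_eq_inj e (@inj_id _)) mul1n.
  rewrite sheared_cover => [|x' y']; last first.
    by apply: sum_slide; rewrite // xpair_eqE eqxx.
  under eq_bigr do rewrite !cc //.
  rewrite big_sumType sum_pairE /= (eq_bigr (fun=> 2)) => [|i _].
    rewrite sum_nat_const card_ord big_const card_unit /=; lia.
  rewrite (shift3 (fun c => ((e == c) * 2 + (e == c + s' i)%R) *
    ((d == c) * 2 + (d == c + s' i)%R))).
  have := s0' i; rewrite !big_ord_recl big_ord0.
  by case: (s' i) e d ed {xy} => [[|[|[|z]]] hz] [[|[|[|e]]] he] [[|[|[|d]]] hd].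
exists (V * 'I_3)%type, _, (sheared (@slide _ false) (B (fun=> 0%R) (fun=> 1%R))),
  (sheared (@slide _ true) (B g s)); split.
- by rewrite card_prod !card_ord mulnC.
- exact: TS.
- exact: TS.
move=> [x e] [y d]; rewrite sheared_cover => [|x' y']; last by apply: sum_slide.
under eq_bigr do rewrite !cc //.
rewrite big_sumType sum_pairE /= big_const card_unit /= addn0 addn1 -(bal e d); congr _.+1.
by apply: eq_bigr => i _; apply: eq_bigr => c _; rewrite addr0.
Qed.

Definition fork_product (g s e d : 'I_3) : nat :=
  \sum_c ((e == c) * 2 + (e == c + 1)%R) * ((d == c + g)%R * 2 + (d == c + g + s)%R).

Lemma fork_product_opposite e d : fork_product 0%R 1%R e d + fork_product (-1)%R (-1)%R e d = 6.
Proof.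
rewrite /fork_product !big_ord_recl !big_ord0.
by case: e d => [[|[|[|e]]] he] [[|[|[|d]]] hd] //; vm_compute.
Qed.

Lemma fork_product_rotations e d :
  fork_product 0%R 1%R e d + fork_product 1%R 1%R e d + fork_product 2%:R%R 1%R e d = 9.
Proof.
rewrite /fork_product !big_ord_recl !big_ord0.
by case: e d => [[|[|[|e]]] he] [[|[|[|d]]] hd] //; vm_compute.
Qed.

(* The products of the two opposite forks, and those of the three rotated forks, are
   constant; the latter are used once when h is odd. *)
Lemma coprime6_design h : coprime h.*2.+1 6 ->
  config_design (3 * h.*2.+1) h.*2.+1 (3 * h).+1.
Proof.
move=> h6.
pose G e d b := if b then fork_product (-1)%R (-1)%R e d else fork_product 0%R 1%R e d.
have [h_odd|h_even] := boolP (odd h); last first.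
  pose g (i : 'I_h) : 'I_3 := if odd i then (-1)%R else 0%R.
  pose s (i : 'I_h) : 'I_3 := if odd i then (-1)%R else 1%R.
  apply: (slid_forks_design (g := g) (s := s)) => // [i|e d]; first by rewrite /s; case: odd.
  rewrite (eq_bigr (fun i : 'I_h => G e d (odd i))) => [|i _]; last by rewrite /g /s; case: odd.
  have hE : h = h./2.*2 by rewrite even_halfK.
  by rewrite [in LHS]hE sum_bool_halves /G fork_product_opposite; lia.
(* For h = 1 the modulus would be 3, which is not prime to 6; so there is room for the three
   rotations. *)
have h3 : 2 < h by case: h h6 h_odd {G} => [|[|[|h]]].
have hE : h = (h - 3)./2.*2.+3 by lia.
pose g (i : 'I_h) : 'I_3 := if i < 3 then i%:R%R else if odd i then 0%R else (-1)%R.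
pose s (i : 'I_h) : 'I_3 := if i < 3 then 1%R else if odd i then 1%R else (-1)%R.
apply: (slid_forks_design (g := g) (s := s)) => // [i|e d].
  by rewrite /s; case: ltnP => // _; case: odd.
pose H i := if i < 3 then fork_product i%:R%R 1%R e d else G e d (~~ odd i).
rewrite (eq_bigr (fun i : 'I_h => H i)) => [|i _]; last first.
  by rewrite /g /s /H; case: ltnP => // _; case: odd.
transitivity (\sum_(i < (h - 3)./2.*2.+3) H i); first by rewrite -hE.
have -> : 3 * h = 9 + (h - 3)./2 * 6 by lia.
move: (h - 3)./2 => k; have H012 : H 0 + H 1 + H 2 = 9 := fork_product_rotations e d.
rewrite 3!big_ord_recl !addnA -[H _ + H _ + H _]/(H 0 + H 1 + H 2) H012; congr (_ + _).
have G01 : G e d false + G e d true = 6 := fork_product_opposite e d.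
rewrite -G01 -sum_bool_halves; apply: eq_bigr => i _.
by rewrite /H /bump /= add0n; case: odd.
Qed.

(** * Triple systems of arithmetic progressions *)

Lemma sum_translates (V : finZmodType) (u v a b : V) :
  \sum_y (u == y + a)%R * (v == y + b)%R = (v - u == b - a)%R.
Proof.
transitivity (\sum_y (u - a == y)%R * (v == y + b)%R).
  by apply: eq_bigr => y _; rewrite subr_eq.
rewrite sum_delta -subr_eq0 -[in RHS]subr_eq0; congr (nat_of_bool (_ == _)).
by rewrite !opprD !opprK !addrA; rewrite addrAC -!addrA; congr (_ + _)%R; rewrite addrCA.
Qed.

(** The progression y - d, y, y + d has the differences d and -d twice, and 2 d and -2 d once. *)
Definition progression_count (V : zmodType) (d r : V) : nat :=
  2 * ((r == d) + (r == - d)%R) + ((r == d + d)%R + (r == - (d + d))%R).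

(** Writing [k.2 + 0] gives all three points the shape treated by [sum_translates]. *)
Lemma decomposes_progressions (V : finZmodType) (I : finType) (d : I -> V) :
  (forall i, d i != 0%R /\ (d i + d i)%R != 0%R) ->
  decomposes (fun k : I * V => [set (k.2 + 0)%R; (k.2 + d k.1)%R; (k.2 - d k.1)%R])
    (fun x y => \sum_i progression_count (d i) (y - x)%R).
Proof.
move=> d0.
have neq i y : [/\ (y + 0 != y + d i)%R, (y + 0 != y - d i)%R & (y + d i != y - d i)%R].
  have [di ddi] := d0 i; rewrite !(inj_eq (addrI y)) ![(0 == _)%R]eq_sym oppr_eq0.
  by split=> //; rewrite -subr_eq0 opprK.
split=> [[i y]|u v uv] /=; first by have [? ? ?] := neq i y; rewrite set3_card.
have r0 : (v - u == 0)%R = false by rewrite subr_eq0 eq_sym (negPf uv).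
rewrite /cross_cover sum_pairE; apply: eq_bigr => i _ /=.
under eq_bigr => y _.
  have [n1 n2 n3] := neq i y; rewrite !mem_set3 // !mulnDl !mulnDr; over.
rewrite !big_split /= !sum_translates !subrr r0 !subr0 !sub0r opprK -opprD /progression_count.
by do 4![case: (_ == _)].
Qed.

(** The steps and their negatives exhaust the nonzero residues, which gives 2; as doubling is
    bijective, so do their doubles, which gives 1 more. *)
Lemma sum_progression_count h (r : 'I_h.*2.+1) : r != 0%R ->
  \sum_(i < h) progression_count (inord i.+1) r = 3.
Proof.
move=> r0; have di : injective (fun x : 'I_h.*2.+1 => x + x)%R.
  by apply: double_inj_ord; rewrite /= odd_double.
have dE a b : (a + a == b + b)%R = (a == b) := inj_eq di a b.
have rE : r = (invF di r + invF di r)%R by rewrite (f_invF di).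
have s0 : invF di r != 0%R by apply: contra r0 => /eqP E; rewrite rE E addr0.
rewrite /progression_count big_split -big_distrr /= half_system //.
rewrite -[RHS]/(2 + 1); congr (_ + _); rewrite -[RHS](half_system s0); apply: eq_bigr => i _.
by rewrite {1 2}rE opprD !dE.
Qed.

Lemma inord_succ_neq0 h (i : 'I_h) :
  (inord i.+1 != 0 :> 'I_h.*2.+1)%R /\ (inord i.+1 + inord i.+1 != 0 :> 'I_h.*2.+1)%R.
Proof.
have hi := ltn_ord i; split; first by rewrite -val_eqE /= inordK //; lia.
rewrite -val_eqE /= inordK; last by lia.
by rewrite modn_small; lia.
Qed.

Lemma has_triple_system_odd h : has_triple_system h.*2.+1 3.
Proof.
exists 'I_h.*2.+1, _, (fun k : 'I_h * 'I_h.*2.+1 =>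
  [set (k.2 + 0)%R; (k.2 + inord k.1.+1)%R; (k.2 - inord k.1.+1)%R]).
split; first by rewrite card_ord.
apply: eq_decomposes (decomposes_progressions (@inord_succ_neq0 h)) _.
by move=> x y xy; rewrite sum_progression_count // subr_eq0 eq_sym.
Qed.

(* A triple system TS(6, 2) has ten blocks, which with their complements are all the
   ways to split the six points into two triples. *)
Lemma config_design_6 : config_design 6 4 5.
Proof.
have [P [I [T [cP Tl]]]] := has_triple_system_6k 1.
have cI : #|I| = 10 by have := card_triple_system Tl; rewrite cP /=; lia.
have dT x : \sum_i (x \in T i) = 5 by have := degree_triple_system x Tl; rewrite cP /=; lia.
have T3 i : #|T i| = 3 by exact: Tl.1.
exists P, (I * bool)%type, (fun k => T k.1), (fun k => if k.2 then ~: T k.1 else T k.1).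
split=> // [||x y].
- split=> [[i b]|x y xy] //=.
  by rewrite cross_cover_fst card_bool Tl.2.
- split=> [[i b]|x y xy] /=; first by case: b; rewrite // cardsCs setCK cP T3.
  rewrite /cross_cover sum_pairE; under eq_bigr do rewrite big_bool.
  rewrite big_split /= [X in _ + X](_ : _ = 2); last exact: Tl.2 xy.
  (* By inclusion and exclusion, 10 - 5 - 5 + 2 = 2 complements contain both points. *)
  have : \sum_i ((x \in ~: T i) * (y \in ~: T i) + ((x \in T i) + (y \in T i))) =
      \sum_i (1 + (x \in T i) * (y \in T i)).
    by apply: eq_bigr => i _; rewrite !inE; case: (x \in _); case: (y \in _).
  rewrite !big_split /= !dT [X in _ = _ + X -> _](_ : _ = 2); last exact: Tl.2 xy.
  by rewrite sum_nat_const muln1 [#|_|]cI; lia.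
rewrite /cross_cover sum_pairE -(dT x); apply: eq_bigr => i _; rewrite big_bool /= inE.
by case: (x \in _); case: (y \in _).
Qed.

Lemma decomposes_spokes (V : finZmodType) (J : finType) (a b : J -> V) :
  (forall j, a j != b j) ->
  decomposes (fun k : J * V => [set inl (k.2 + a k.1)%R; inl (k.2 + b k.1)%R; inr tt])
    (fun x y => match x, y with
     | inl u, inl v => \sum_j ((v - u == b j - a j)%R + (v - u == a j - b j)%R)
     | _, _ => 2 * #|J|
     end).
Proof.
move=> ab; pose S k : {set V + unit} := [set inl (k.2 + a k.1)%R; inl (k.2 + b k.1)%R; inr tt].
have neq j y : (inl (y + a j) : V + unit)%R != inl (y + b j)%R.
  by rewrite (inj_eq inl_inj) (inj_eq (addrI y)).
have memE k u : (inl u \in S k) = (u == k.2 + a k.1)%R + (u == k.2 + b k.1)%R :> nat.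
  by rewrite mem_set3 ?neq // addn0.
have memt k : inr tt \in S k by rewrite !inE eqxx orbT.
have mixed u : cross_cover S S (inl u) (inr tt) = 2 * #|J|.
  rewrite /cross_cover sum_pairE (eq_bigr (fun=> 2)) => [|j _].
    by rewrite sum_nat_const mulnC.
  under eq_bigr do rewrite memE memt muln1 /=.
  rewrite big_split /= !(@sum_eq_inj _ (fun y : V => y + _)%R) //; exact: addIr.
split=> [[j y]|[u|[]] [v|[]] xy] /=; first by rewrite set3_card ?neq.
- have {}xy : u != v by apply: contra xy => /eqP->.
  have r0 : (v - u == 0)%R = false by rewrite subr_eq0 eq_sym (negPf xy).
  rewrite -/(cross_cover S S _ _) /cross_cover sum_pairE; apply: eq_bigr => j _.
  under eq_bigr do rewrite !memE /= !mulnDl !mulnDr.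
  by rewrite !big_split /= !sum_translates !subrr r0 addn0 add0n.
- exact: mixed.
- by rewrite -/(cross_cover S S _ _) cross_coverC mixed.
- by rewrite eqxx in xy.
Qed.

(* Two copies of all progressions, those of one step in one copy being
   replaced by their pairs of points together with an additional point. *)
Lemma has_triple_system_even h : has_triple_system h.+1.*2.+2 6.
Proof.
pose V := 'I_h.+1.*2.+1; pose d (i : 'I_h.+1) : V := inord i.+1.
have d0 : forall i, d i != 0%R /\ (d i + d i)%R != 0%R := @inord_succ_neq0 h.+1.
pose e := d ord0; have [e0 ee0] := d0 ord0.
(* Up to translation the pairs of -e, 0, e are {0, e} twice and {-e, e} once. Three edges also make
   the new point meet every point 6 times. *)
pose a (j : 'I_3) : V := if j < 2 then 0%R else (- e)%R.
have ae j : a j != e.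
  rewrite /a; case: ifP => _; first by rewrite eq_sym.
  by rewrite -subr_eq0 -opprD oppr_eq0.
exists (V + unit)%type, _, (sumf
  (fun k => left_part unit (sumf
     (fun k : 'I_h.+1 * V => [set (k.2 + 0)%R; (k.2 + d k.1)%R; (k.2 - d k.1)%R])
     (fun k : 'I_h * V =>
        [set (k.2 + 0)%R; (k.2 + d (lift ord0 k.1))%R; (k.2 - d (lift ord0 k.1))%R]) k))
  (fun k : 'I_3 * V => [set inl (k.2 + a k.1)%R; inl (k.2 + e)%R; inr tt])).
split; first by rewrite card_sum card_ord card_unit addn1.
apply: eq_decomposes (decomposes_sum (decomposes_left unit
  (decomposes_sum (decomposes_progressions d0)
     (decomposes_progressions (fun i => d0 (lift ord0 i)))))
  (@decomposes_spokes _ _ a (fun=> e) ae)) _.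
move=> [u|[]] [v|[]] xy; rewrite ?card_ord //.
have {}xy : u != v by apply: contra xy => /eqP->.
have r0 : (v - u != 0)%R by rewrite subr_eq0 eq_sym.
have S3 : \sum_(i < h.+1) progression_count (d i) (v - u)%R = 3 := sum_progression_count r0.
 transitivity (3 + \sum_(i < h.+1) progression_count (d i) (v - u)%R); last by rewrite S3.
rewrite -addnA; congr (_ + _); first exact: S3.
rewrite [RHS]big_ord_recl [RHS]addnC; congr (_ + _).
rewrite !big_ord_recl big_ord0 /a /= -/(d ord0) -/e /progression_count !subr0 !sub0r opprK -opprD.
by do 4![case: (_ == _)].
Qed.

(** * Placing the missing edges and the octahedron *)

Lemma perm_two_points (T : finType) (a b a' b' : T) : a != b -> a' != b' ->
  exists s : {perm T}, s a = a' /\ s b = b'.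
Proof.
move=> ab ab'; exists (tperm a a' * tperm (tperm a a' b) b')%g.
have ne : tperm a a' b != a' by rewrite -{2}(tpermL a a') (inj_eq perm_inj) eq_sym.
by rewrite !permM (tpermL a a') tpermL tpermD // eq_sym.
Qed.

(** Moves the missing edge to a prescribed pair, since the octahedron dictates it in each column. *)
Lemma decomposes_double_edge_at (P I V : finType) (u v : P) (T : I -> {set P}) (a b : V) :
  #|P| = #|V| -> u != v -> a != b ->
  decomposes T (fun x y => 2 - double_edge u v x y) ->
  exists S : I -> {set V}, decomposes S (fun x y => 2 - double_edge a b x y).
Proof.
move=> /esym/bijection_of_card[g gb] uv ab Tuv; have [h gK hK] := gb.
have huv : h u != h v by rewrite (can_eq hK).
have [s [sa sb]] := perm_two_points ab huv.
pose g' := g \o s; have g'b : bijective g' by apply: bij_comp gb (injF_bij (@perm_inj _ s)).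
have ga : g' a = u by rewrite /g' /= sa hK.
have gb' : g' b = v by rewrite /g' /= sb hK.
exists (fun i => g' @^-1: T i); apply: eq_decomposes (decomposes_preim g'b Tuv) _.
by move=> x y _; rewrite /double_edge -ga -gb' !(inj_eq (bij_inj g'b)).
Qed.

(** With m = 2 k, the element k has order 2. The octahedron has the points 0, k in the outer columns
    and 0, y in the middle one, where y is k / 2 rounded down. *)
Lemma exchanged_design_6k2 j : 0 < j ->
  config_design (3 * (6 * j).+2) (2 * (6 * j).+2) (3 * (6 * j).+2).-1.
Proof.
move=> j0; have [k kE] : exists k, k = (3 * j).+1 by eexists.
pose V := 'I_(6 * j).+2.
have [P [I [u [v [T [cP uv Tuv]]]]]] := double_edge_packing j.
pose kk : V := inord k; pose yy : V := inord k./2.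
pose w (c : 'I_3) (b : bool) : V := if b then (if c == 1%R then yy else kk) else 0%R.
have mE : (6 * j).+2 = k + k by rewrite kE; lia.
have vk : val kk = k by rewrite /= inordK //; lia.
have vy : val yy = k./2 by rewrite /= inordK //; lia.
have kk0 : (kk + kk = 0)%R by apply: val_inj; rewrite /= vk -mE modnn.
have yk : (yy + yy + (odd k)%:R = kk)%R.
  have v1 (b : bool) : val (b%:R : V)%R = b by case: b; rewrite //= modn_small.
  apply: val_inj; rewrite /= v1 vk vy modnDml (_ : k./2 + k./2 + odd k = k) ?modn_small //; lia.
have kk_neq0 : kk != 0%R by rewrite -val_eqE /= vk kE.
have yy_neq0 : yy != 0%R by rewrite -val_eqE /= vy; lia.
have yk_neq : yy != kk by rewrite -val_eqE /= vk vy; lia.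
have w_inj c : w c false != w c true by rewrite /w eq_sym; case: ifP.
have {Tuv} [S Sw] : exists S : 'I_3 -> I -> {set V}, forall c,
    decomposes (S c) (fun x y => 2 - double_edge (w c false) (w c true) x y).
  apply: (@fin_all_exists _ (fun=> I -> {set V}) (fun c S =>
    decomposes S (fun x y => 2 - double_edge (w c false) (w c true) x y))) => c.
  apply: decomposes_double_edge_at (w_inj c) Tuv => //.
  by rewrite cP card_ord.
(* Solves for the transversal from its points in columns 0 and 1. As 2 y + (k mod 2) = k and 2 k =
   0, its point in column 2 is k exactly when the two bits differ. *)
pose s (b : bool * bool) : (V * bool) * V :=
  (((if b.2 then yy else 0) - (if b.1 then kk else 0), b.2 && odd k), if b.1 then kk else 0)%R.
have D := @exchanged_design I V (V * bool)%type S (@perturbed (6 * j)) w s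
  w_inj Sw (even_transversals _).
rewrite card_prod card_ord card_bool in D; apply: D; [|move=> b b'|lia|lia].
  move=> [b0 b1] c; rewrite /perturbed /s /w /parity_bits; case: c => [[|[|[|c]]] hc] //=.
  - by rewrite andbF mulr0n !addr0.
  - by rewrite andbF mulr1n addr0 addrC subrK.
  rewrite andbT mulr2n addrACA -opprD; case: b0 => /=.
    rewrite kk0 subr0; case: b1 => /=; last by rewrite !addr0.
    by rewrite yk kk0.
  by rewrite addr0 subr0 add0r; case: b1 => //=; rewrite !addr0.
have Nkk : (- kk = kk)%R by apply/eqP; rewrite eq_sym -addr_eq0 kk0.
have e1 : (yy + kk == kk)%R = false by rewrite -subr_eq0 addrK (negPf yy_neq0).
have e2 : (yy + kk == yy)%R = false by rewrite addrC -subr_eq0 addrK (negPf kk_neq0).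
have e3 : (yy + kk == 0)%R = false by rewrite addr_eq0 Nkk (negPf yk_neq).
have [[e4 e5] e6] := (negPf kk_neq0, negPf yy_neq0, negPf yk_neq).
case: b b' => [] [] [] [[] []] //=; rewrite ?subr0 ?sub0r ?Nkk;
  move=> /(congr1 fst) /eqP; rewrite /= ?e1 ?e2 ?e3 ?e4 ?e5 ?e6 // eq_sym;
  by rewrite /= ?e1 ?e2 ?e3 ?e4 ?e5 ?e6.
Qed.

(** * Designs for each residue class modulo 6 *)

Lemma config_design_6k1 k : config_design (6 * k).+1 (6 * k).+1 (9 * k).
Proof.
have [P [I [T [cP Tl]]]] := has_steiner_triple_system_6k1 k.
by rewrite -{2}[(6 * k).+1]mul1n; apply: shift_design cP _ Tl _ => //=; lia.
Qed.

Lemma config_design_6k2 k : 0 < k ->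
  config_design (6 * k).+2 (6 * (6 * k).+2) (9 * (6 * k).+1).
Proof.
move=> k0; have [P [I [T [cP Tl]]]] := has_triple_system_even (3 * k).-1.
have nE : (3 * k).-1.+1.*2.+2 = (6 * k).+2 by lia.
by rewrite nE in cP; apply: shift_design cP _ Tl _ => //=; lia.
Qed.

Lemma config_design_6k4 k : config_design (6 * k + 4) (2 * (6 * k + 4)) (3 * (6 * k + 3)).
Proof.
have [|P [I [T [cP Tl]]]] := @has_triple_system_3q1 (2 * k).+1; first by lia.
have nE : (3 * (2 * k).+1).+1 = 6 * k + 4 by lia.
by rewrite nE in cP; apply: shift_design cP _ Tl _ => //=; lia.
Qed.

Lemma config_design_6k5 k : config_design (6 * k + 5) (3 * (6 * k + 5)) (9 * (3 * k + 2)).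
Proof.
have [P [I [T [cP Tl]]]] := has_triple_system_odd (3 * k + 2).
have nE : (3 * k + 2).*2.+1 = 6 * k + 5 by lia.
by rewrite nE in cP; apply: shift_design cP _ Tl _ => //=; lia.
Qed.

(** Here n = 3 m with m = 2 k + 1. If m is prime to 6, slid forks apply; otherwise 3 divides m and
    Bose's system on m points is inflated. *)
Lemma config_design_6k3 k : config_design (6 * k + 3) (2 * k).+1 (3 * k).+1.
Proof.
have nE : 6 * k + 3 = 3 * k.*2.+1 by lia.
have [k6|k6] := boolP (coprime k.*2.+1 6).
  by rewrite nE mul2n; exact: coprime6_design.
have k3 : 3 %| k.*2.+1.
  move: k6; rewrite -[6]/(2 * 3) coprimeMr coprimen2 /= odd_double /= coprime_sym.
  by rewrite prime_coprime // negbK.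
have [|P [I [T [cP Tl]]]] := @has_steiner_triple_system_3q (k.*2.+1 %/ 3); first by lia.
have {}cP : #|P| = k.*2.+1 by rewrite cP; lia.
have [S Sl] : exists S : I -> {set 'I_k.*2.+1}, triple_system S 1.
  by apply: triple_system_transport Tl; rewrite card_ord.
have := @inflated_design I 'I_k.*2.+1 'I_k.*2.+1 S _ 1 k Sl (odd_transversals _).
rewrite card_ord nE !mul1n !mul2n => H.
have -> : (3 * k).+1 = k + k.*2.+1 by lia.
apply: H => [x xx| |]; [|lia|lia].
by apply: (double_inj_ord (n := k.*2)); rewrite /= ?odd_double ?addr0.
Qed.

Lemma inflated_even_design m : 0 < m -> has_triple_system m.*2 2 ->
  config_design (3 * m.*2) (2 * m.*2) (3 * m.*2).-1.
Proof.
case: m => // m _ [P [I [T [cP Tl]]]].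
have [S Sl] : exists S : I -> {set 'I_m.*2.+2}, triple_system S 2.
  by apply: triple_system_transport Tl; rewrite card_ord.
have := @inflated_design I 'I_m.*2.+2 ('I_m.*2.+2 * bool)%type S _ 2 m.*2.+1
  Sl (even_transversals _).
rewrite card_prod card_bool card_ord -doubleS => H.
have -> : (3 * m.+1.*2).-1 = m.*2.+1 + m.+1.*2 * 2 by lia.
by apply: H; lia.
Qed.

(** With n = 3 m and m = 2 k, the residues 0 and 4 of m modulo 6 have a TS(m, 2) to inflate; residue
    2 requires the exchange, apart from m = 2, which is done by hand. *)
Lemma config_design_6k k : 0 < k -> config_design (6 * k) (4 * k) (6 * k).-1.
Proof.
move=> k0; have -> : 6 * k = 3 * k.*2 by lia.
have -> : 4 * k = 2 * k.*2 by lia.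
have [k3|[k3|k3]] : k %% 3 = 0 \/ k %% 3 = 1 \/ k %% 3 = 2 by lia.
- apply: inflated_even_design => //.
  by rewrite (_ : k.*2 = 6 * (k %/ 3)); [exact: has_triple_system_6k|lia].
- have [->|k1] := eqVneq k 1; first exact: config_design_6.
  by rewrite (_ : k.*2 = (6 * (k %/ 3)).+2); [apply: exchanged_design_6k2; lia|lia].
- apply: inflated_even_design => //.
  by rewrite (_ : k.*2 = (3 * (2 * (k %/ 3)).+1).+1); [apply: has_triple_system_3q1; lia|lia].
Qed.

(** * Indices *)

Lemma ratio_eq_nat n l1 l2 : 0 < n ->
  (l2%:R = 3 * l1%:R * (n%:R - 1) / (2 * n%:R) :> rat)%R <-> l2 * (2 * n) = 3 * l1 * n.-1.
Proof.
case: n => // n _.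
have n0 : (2 * n.+1%:R != 0 :> rat)%R by rewrite mulf_neq0 // pnatr_eq0.
have -> : (n.+1%:R - 1 = n%:R :> rat)%R by rewrite -natr1 addrK.
rewrite /=; split=> [E|/(congr1 (fun i => i%:R : rat)%R)].
  apply/eqP; rewrite -(eqr_nat rat) !natrM E divfK //.
by rewrite !natrM => E; apply: (mulIf n0); rewrite divfK.
Qed.

(** By the ratio, twice the two quantities are 5 a n (n - 1) and 5 a (n - 1), and 2 is prime to
    15. *)
Lemma dvdn_indices n a b t : b * (2 * n) = 3 * a * n.-1 ->
  (15 %| t * (a * n * (n - 1) + b * n ^ 2)) = (3 %| t * (a * n * n.-1)) /\
  5 %| a * (n - 1) + b * n.
Proof.
move=> ratio; rewrite subn1.
have E1 : 2 * (a * n * n.-1 + b * n ^ 2) = 5 * (a * n * n.-1).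
  have -> : 2 * (a * n * n.-1 + b * n ^ 2) = 2 * (a * n * n.-1) + b * (2 * n) * n.
    by rewrite -mulnn mulnDr; congr (_ + _); clear; lia.
  by rewrite ratio; clear; lia.
have E2 : 2 * (a * n.-1 + b * n) = 5 * (a * n.-1).
  have -> : 2 * (a * n.-1 + b * n) = 2 * (a * n.-1) + b * (2 * n) by clear; lia.
  by rewrite ratio; clear; lia.
split; last by rewrite -(@Gauss_dvdr 5 2) // E2 dvdn_mulr.
rewrite -(@Gauss_dvdr 15 2) // mulnCA E1 mulnCA -[15]/(5 * 3) dvdn_pmul2l //.
Qed.

(* The prescribed ratio forces (l1, l2) = (a t, b t), and then the divisibility
   conditions only say that 3 divides t a n (n - 1). *)
Lemma minimal_indices_of_coprime n a b :
  1 < n -> 0 < a -> 0 < b -> coprime a b -> b * (2 * n) = 3 * a * n.-1 ->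
  let c := if 3 %| a * n * n.-1 then 1 else 3 in
  minimal_indices_3_3 n (c * a) (c * b).
Proof.
move=> n1 a0 b0 ab ratio c; have n_gt0 := ltnW n1.
have c0 : 0 < c by rewrite /c; case: ifP.
have d15 t := dvdn_indices t ratio; split.
  split; rewrite ?muln_gt0 ?c0 //.
  - by apply/ratio_eq_nat; rewrite // -mulnA ratio !mulnA [c * 3]mulnC.
  - rewrite -!mulnA -mulnDr [a * (n * _)]mulnA (d15 c).1 // /c; case: ifP => [? | _].
      by rewrite mul1n.
    exact: dvdn_mulr.
  - by rewrite -!mulnA -mulnDr dvdn_mull // (d15 0).2.
move=> l1 l2 [l10 l20 /ratio_eq_nat E d15' _].
have {}E : l2 * a = l1 * b.
  have E' := E n_gt0; have n2 : 0 < 2 * n by rewrite muln_gt0.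
  apply/eqP; rewrite -(eqn_pmul2r n2) mulnAC E' -[l1 * b * _]mulnA ratio; apply/eqP.
  by clear; lia.
have /dvdnP[t l1E] : a %| l1 by rewrite -(Gauss_dvdl _ ab) -E dvdn_mull.
have l2E : l2 = t * b by apply/eqP; rewrite -(eqn_pmul2r a0) E l1E mulnAC.
have /dvdnP[t' tE] : c %| t.
  move: d15'; rewrite l1E l2E -!mulnA -mulnDr [a * (n * _)]mulnA (d15 t).1 Euclid_dvdM // /c.
  by case: (3 %| _ * n.-1); rewrite ?dvd1n ?orbF.
have t'0 : 0 < t' by move: l10; rewrite l1E tE !muln_gt0 -andbA => /andP[].
by rewrite l1E l2E tE -!mulnA !leq_pmull.
Qed.

Lemma indices_formula_intro n l1 l2 : 0 < n ->
  [\/ n %% 6 = 0 /\ (3 * l1 = 2 * n /\ l2 = n.-1),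
      n %% 6 = 1 /\ (l1 = n /\ 2 * l2 = 3 * n.-1)
    | [\/ n %% 6 = 2 /\ (l1 = 6 * n /\ l2 = 9 * n.-1),
          n %% 6 = 3 /\ (3 * l1 = n /\ 2 * l2 = n.-1),
          n %% 6 = 4 /\ (l1 = 2 * n /\ l2 = 3 * n.-1)
        | n %% 6 = 5 /\ (l1 = 3 * n /\ 2 * l2 = 9 * n.-1)]] ->
  indices_formula_3_3 n l1 l2.
Proof.
case: n => // n _ H.
have qE : (n.+1%:R = n%:R + 1 :> rat)%R by rewrite natr1.
have toQ (a b : nat) : a = b -> (a%:R = b%:R :> rat)%R by move=> ->.
by case: H => [[r [/toQ E1 /toQ E2]]|[r [/toQ E1 /toQ E2]]|
  [[r [/toQ E1 /toQ E2]]|[r [/toQ E1 /toQ E2]]|[r [/toQ E1 /toQ E2]]|[r [/toQ E1 /toQ E2]]]];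
  rewrite /indices_formula_3_3; (split; last split); rewrite r // => _;
  rewrite /= ?natrM ?qE in E1 E2 *; split; lra.
Qed.

Lemma coprime_of_bezout a b u v : u * a = v * b + 1 -> coprime a b.
Proof.
move=> E; rewrite /coprime -dvdn1 -(dvdn_addr 1 (dvdn_mull v (dvdn_gcdr a b))) -E.
exact: dvdn_mull (dvdn_gcdl a b).
Qed.

Lemma exists_minimal_design n : 3 <= n -> exists l1 l2,
  [/\ minimal_indices_3_3 n l1 l2, indices_formula_3_3 n l1 l2 & config_design n l1 l2].
Proof.
move=> n3; pose k := n %/ 6; have n_gt0 : 0 < n by lia.
(* In [min3] the number 3 divides a n (n - 1); in [min1] it does not and the coprime pair is
   tripled, as happens for n = 2 and 5 modulo 6. *)
have min3 a b : 0 < a -> 0 < b -> coprime a b -> b * (2 * n) = 3 * a * n.-1 ->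
    [|| 3 %| a, 3 %| n | 3 %| n.-1] -> minimal_indices_3_3 n a b.
  move=> a0 b0 ab ratio d3.
  have := @minimal_indices_of_coprime n a b (ltnW n3) a0 b0 ab ratio.
  by rewrite /= !Euclid_dvdM // -orbA d3 !mul1n.
have min1 a b : 0 < a -> 0 < b -> coprime a b -> b * (2 * n) = 3 * a * n.-1 ->
    ~~ [|| 3 %| a, 3 %| n | 3 %| n.-1] -> minimal_indices_3_3 n (3 * a) (3 * b).
  move=> a0 b0 ab ratio /negPf d3.
  have := @minimal_indices_of_coprime n a b (ltnW n3) a0 b0 ab ratio.
  by rewrite /= !Euclid_dvdM // -orbA d3.
have [r|[r|[r|[r|[r|r]]]]] : n = 6 * k \/ n = (6 * k).+1 \/ n = (6 * k).+2 \/
    n = 6 * k + 3 \/ n = 6 * k + 4 \/ n = 6 * k + 5 by lia.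
- exists (4 * k), (6 * k).-1; split.
  + apply: min3; rewrite ?r; try lia.
    rewrite -[4]/(2 ^ 2) coprimeMl coprime_pexpl // coprime2n; apply/andP; split; first lia.
    by apply: (@coprime_of_bezout _ _ 6 1); lia.
  + by apply: indices_formula_intro => //; constructor 1; lia.
  + by rewrite r; apply: config_design_6k; lia.
- exists n, (9 * k); split.
  + apply: min3; rewrite ?r; try lia.
    rewrite -[9]/(3 ^ 2) coprimeMr coprime_pexpr //; apply/andP; split.
      by apply: (@coprime_of_bezout _ _ 1 (2 * k)); lia.
    by apply: (@coprime_of_bezout _ _ 1 6); lia.
  + by apply: indices_formula_intro => //; constructor 2; lia.
  + by rewrite r; apply: config_design_6k1.
- exists (3 * (2 * n)), (3 * (3 * n.-1)); split.
  + apply: min1; rewrite ?r; try lia.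
    rewrite coprimeMr !coprimeMl; apply/and3P; split=> //.
    * by apply: (@coprime_of_bezout _ _ 2 (4 * k).+1); lia.
    * by rewrite coprime2n; lia.
    * by apply: (@coprime_of_bezout _ _ 1 1); lia.
  + by apply: indices_formula_intro => //; constructor 3; constructor 1; lia.
  + rewrite !mulnA (_ : 3 * 2 = 6) // (_ : 3 * 3 = 9) // r; apply: config_design_6k2; lia.
- exists (2 * k).+1, (3 * k).+1; split.
  + apply: min3; rewrite ?r; try lia.
    by apply: (@coprime_of_bezout _ _ 3 2); lia.
  + by apply: indices_formula_intro => //; constructor 3; constructor 2; lia.
  + by rewrite r; apply: config_design_6k3; lia.
- exists (2 * n), (3 * n.-1); split.
  + apply: min3; rewrite ?r; try lia.
    rewrite coprimeMr !coprimeMl; apply/andP; split; first apply/andP; first split=> //.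
    * by apply: (@coprime_of_bezout _ _ 1 (2 * k).+1); lia.
    * apply/andP; split; first by rewrite coprime2n; lia.
      by apply: (@coprime_of_bezout _ _ 1 1); lia.
  + by apply: indices_formula_intro => //; constructor 3; constructor 3; lia.
  + by rewrite (_ : n.-1 = 6 * k + 3) ?r; [exact: config_design_6k4|lia].
- exists (3 * n), (3 * (3 * (3 * k + 2))); split.
  + apply: min1; rewrite ?r; try lia.
    rewrite coprimeMr; apply/andP; split.
    * by apply: (@coprime_of_bezout _ _ 2 (4 * k + 3)); lia.
    * by apply: (@coprime_of_bezout _ _ 1 2); lia.
  + by apply: indices_formula_intro => //; constructor 3; constructor 4; lia.
  + by rewrite (mulnA 3 3) r; apply: config_design_6k5.
Qed.

Theorem theorem3p11 (n : nat) (hn : 3 <= n) :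
  exists l1 l2 : nat,
    [/\ minimal_indices_3_3 n l1 l2,
        indices_formula_3_3 n l1 l2
      & exists (X : finType) (G : {set {set X}}) (Bs : seq {set X}),
          is_gdd n 2 6 l1 l2 G Bs /\ has_configuration_3_3 G Bs].
Proof.
have [l1 [l2 [minl formula design]]] := exists_minimal_design hn.
exists l1, l2; split=> //; apply: gdd_of_config_design design.
exact: leq_trans hn.
Qed.
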